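(* On the Carnot group $\mathfrak{G}$ (described in the context) with the left-invariant sub-Finsler structure given, for $\xi=\sum_{i=1}^6\eta_ig_i(x)\in T_x\mathfrak{G}$, by $$\|\xi\|=\begin{cases}\max\{|\eta_1|,|\eta_2|\},&\text{if }\eta_3=\eta_4=\eta_5=\eta_6=0,\\ +\infty,&\text{otherwise},\end{cases}$$ there exist pairs of points such that they are connected by a unique shortest path, and this shortest path exhibits chattering.
   Context: The group $\mathfrak{G}$ is $\mathbb{R}^6=\{x=(x_1,\dots,x_6)\}$ with multiplication $z=x*y$ given by $z_1=x_1+y_1$, $z_2=x_2+y_2$, $z_3=x_3+y_3-x_2y_1$, $z_4=x_4+y_4-x_3y_1+\frac12x_2y_1^2$, $z_5=x_5+y_5+x_1y_4-x_1x_3y_1+\frac13x_2y_1^3-\frac12x_3y_1^2+\frac12x_1x_2y_1^2$, $z_6=x_6+y_6-x_3y_4+x_2y_5+\frac12x_3^2y_1-\frac12x_2x_3y_1^2+\frac16x_2^2y_1^3$. It is a simply connected Carnot group of step 5 with growth vector $(2,1,1,1,1)$. The vector fields $g_1=(1,0,-x_2,-x_3,-x_1x_3,\frac12x_3^2)$, $g_2=(0,1,0,0,0,0)$, $g_3=(0,0,1,0,0,0)$, $g_4=(0,0,0,1,x_1,-x_3)$, $g_5=(0,0,0,0,1,x_2)$, $g_6=(0,0,0,0,0,1)$ form a basis of left-invariant vector fields, with nontrivial brackets $[g_1,g_2]=g_3$, $[g_1,g_3]=g_4$, $[g_1,g_4]=g_5$, $[g_2,g_5]=-[g_3,g_4]=g_6$.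 The length of an absolutely continuous curve is $\int\|\dot x\|\,dt$; a shortest path is a curve of minimal length among curves connecting its endpoints (uniqueness is understood for naturally parameterized curves, $\|\dot x\|=1$, i.e. solutions of the time-optimal problem $\dot x=vg_1(x)+ug_2(x)$, $|u|\le1$, $|v|\le1$, $T\to\min$). A path exhibits chattering if its control has a countably infinite number of switches (jumps between vertices of the control set) on arbitrarily small time intervals, i.e. infinitely many switches accumulating at some time moment. *)

(* Defs.v *)
From HB Require Import structures.
From mathcomp Require Import all_boot all_order all_algebra.
From mathcomp Require Import all_classical all_reals all_analysis.
From mathcomp Require Import ring.

Set Implicit Arguments.
Unset Strict Implicit.
Unset Printing Implicit Defensive.

Import Order.TTheory GRing.Theory Num.Theory.
Import numFieldNormedType.Exports.

Local Open Scope classical_set_scope.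
Local Open Scope ring_scope.

Definition vec6 (R : realType) (a b c d e f : R) : 'rV[R]_6 :=
  \row_(i < 6) [:: a; b; c; d; e; f]`_i.

(* [x..[k]] is the k-th coordinate in the numbering 1, ..., 6; [inord] is
   only meaningful for 1 <= k <= 6. *)
Definition co (R : realType) (x : 'rV[R]_6) (k : nat) : R :=
  x ord0 (inord k.-1).
Notation "x ..[ k ]" := (co x k)
  (at level 1, left associativity, format "x ..[ k ]") : ring_scope.

Definition gmul (R : realType) (x y : 'rV[R]_6) : 'rV[R]_6 :=
  vec6
    (x..[1] + y..[1])
    (x..[2] + y..[2])
    (x..[3] + y..[3] - x..[2] * y..[1])
    (x..[4] + y..[4] - x..[3] * y..[1] + 2^-1 * x..[2] * y..[1] ^+ 2)
    (x..[5] + y..[5] + x..[1] * y..[4] - x..[1] * x..[3] * y..[1]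
       + 3^-1 * x..[2] * y..[1] ^+ 3 - 2^-1 * x..[3] * y..[1] ^+ 2
       + 2^-1 * x..[1] * x..[2] * y..[1] ^+ 2)
    (x..[6] + y..[6] - x..[3] * y..[4] + x..[2] * y..[5]
       + 2^-1 * x..[3] ^+ 2 * y..[1] - 2^-1 * x..[2] * x..[3] * y..[1] ^+ 2
       + 6^-1 * x..[2] ^+ 2 * y..[1] ^+ 3).

Definition g1 (R : realType) (x : 'rV[R]_6) : 'rV[R]_6 :=
  vec6 1 0 (- x..[2]) (- x..[3]) (- (x..[1] * x..[3])) (2^-1 * x..[3] ^+ 2).
Definition g2 (R : realType) (x : 'rV[R]_6) : 'rV[R]_6 := vec6 0 1 0 0 0 0.
Definition g3 (R : realType) (x : 'rV[R]_6) : 'rV[R]_6 := vec6 0 0 1 0 0 0.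
Definition g4 (R : realType) (x : 'rV[R]_6) : 'rV[R]_6 :=
  vec6 0 0 0 1 x..[1] (- x..[3]).
Definition g5 (R : realType) (x : 'rV[R]_6) : 'rV[R]_6 :=
  vec6 0 0 0 0 1 x..[2].
Definition g6 (R : realType) (x : 'rV[R]_6) : 'rV[R]_6 := vec6 0 0 0 0 0 1.

Definition frame (R : realType) (x : 'rV[R]_6) : 'M[R]_6 :=
  \matrix_(i < 6) [:: g1 x; g2 x; g3 x; g4 x; g5 x; g6 x]`_i.

Lemma co_vec6 (R : realType) (a b c d e f : R) (k : nat) :
  (k.-1 < 6)%N -> (vec6 a b c d e f)..[k] = [:: a; b; c; d; e; f]`_(k.-1).
Proof. by move=> k6; rewrite /co mxE inordK. Qed.

Lemma gmulA (R : realType) : associative (@gmul R).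
Proof.
move=> x y z; rewrite {1 3}/gmul.
by congr vec6; rewrite !co_vec6//=; field.
Qed.

Lemma gmul0r (R : realType) : left_id 0 (@gmul R).
Proof.
move=> x; apply/rowP => -[[|[|[|[|[|[|//]]]]]] h];
  rewrite !mxE/= /co !mxE ?mulr0 ?mul0r ?expr0n/= ?mulr0 ?mul0r ?oppr0
    ?addr0 ?add0r; congr (x _ _); apply/val_inj; by rewrite /= inordK.
Qed.

Lemma gmulr0 (R : realType) : right_id 0 (@gmul R).
Proof.
move=> x; apply/rowP => -[[|[|[|[|[|[|//]]]]]] h];
  rewrite !mxE/= /co !mxE ?expr0n/= ?mulr0 ?oppr0
    ?addr0; congr (x _ _); apply/val_inj; by rewrite /= inordK.
Qed.

Lemma gmulrV (R : realType) (x : 'rV[R]_6) : exists y, gmul x y = 0.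
Proof.
pose y3 := - x..[3] - x..[1] * x..[2].
pose y4 := - x..[4] - x..[3] * x..[1] - 2^-1 * x..[2] * x..[1] ^+ 2.
pose y5 := - x..[5] - x..[1] * y4 - x..[1] ^+ 2 * x..[3]
  + 3^-1 * x..[2] * x..[1] ^+ 3 + 2^-1 * x..[3] * x..[1] ^+ 2
  - 2^-1 * x..[2] * x..[1] ^+ 3.
pose y6 := - x..[6] + x..[3] * y4 - x..[2] * y5
  + 2^-1 * x..[3] ^+ 2 * x..[1] + 2^-1 * x..[2] * x..[3] * x..[1] ^+ 2
  + 6^-1 * x..[2] ^+ 2 * x..[1] ^+ 3.
exists (vec6 (- x..[1]) (- x..[2]) y3 y4 y5 y6).
rewrite /gmul !co_vec6//=; apply/rowP.
rewrite /y6 /y5 /y4 /y3 {y3 y4 y5 y6}.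
by case=> -[|[|[|[|[|[|//]]]]]] h; rewrite !mxE/=; field.
Qed.

Lemma frame_unit (R : realType) (x : 'rV[R]_6) : frame x \in unitmx.
Proof.
rewrite unitmxE -det_tr det_trig.
  rewrite (_ : \prod_i _ = 1) ?unitr1//.
  by rewrite big1// => -[[|[|[|[|[|[|//]]]]]] h] _; rewrite !mxE.
apply/is_trig_mxP => -[i hi] [j hj] /= ij; rewrite !mxE/=.
by move: i hi j hj ij => [|[|[|[|[|[|//]]]]]] hi [|[|[|[|[|[|//]]]]]] hj //= _;
  rewrite mxE.
Qed.

Lemma is_derive_cubic (R : realType) (a b c d : R) :
  is_derive (0 : R) 1
    (fun h : R => a + b * h + c * h ^+ 2 + d * h ^+ 3) b.
Proof.
apply: is_derive_eq.
by rewrite /GRing.scale/=; ring.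
Qed.

(* g_i is the left-invariant vector field whose value at the unit 0 is the i-th
   standard basis vector. *)
Lemma frame_left_invariant (R : realType) (x : 'rV[R]_6) (i j : 'I_6) :
  is_derive (0 : R) 1 (fun h : R => gmul x (h *: delta_mx 0 i) 0 j)
    (frame x i j).
Proof.
pose c := if i == 0 then [:: 0; 0; 0; 2^-1 * x..[2];
  2^-1 * x..[1] * x..[2] - 2^-1 * x..[3]; - (2^-1 * x..[2] * x..[3])]`_j else 0.
pose d := if i == 0 then [:: 0; 0; 0; 0; 3^-1 * x..[2];
  6^-1 * x..[2] ^+ 2]`_j else 0.
have coZ (h : R) k : (k < 6)%N -> (h *: delta_mx 0 i)..[k.+1] =
    h * (i == k :> nat)%:R.
  by move=> k6; rewrite /co !mxE eqxx /= -val_eqE /= inordK// eq_sym.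
rewrite (_ : (fun h : R => _) =
  fun h => x..[j.+1] + frame x i j * h + c * h ^+ 2 + d * h ^+ 3).
  exact: is_derive_cubic.
apply/funext => h; rewrite /gmul mxE !coZ// mxE {}/c {}/d -val_eqE {coZ}.
case: i j => -[|[|[|[|[|[|//]]]]]] hi [[|[|[|[|[|[|//]]]]]] hj] /=;
  by rewrite mxE/=; ring.
Qed.

(* Coordinates of the tangent vector [xi] at [x] in the basis g_1, ..., g_6. *)
Definition coords (R : realType) (x xi : 'rV[R]_6) : 'rV[R]_6 :=
  xi *m invmx (frame x).

Lemma coordsP (R : realType) (x xi eta : 'rV[R]_6) :
  xi = \sum_(i < 6) eta 0 i *: row i (frame x) <-> eta = coords x xi.
Proof.
rewrite /coords -mulmx_sum_row; split=> [->|->].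
  by rewrite mulmxK ?frame_unit.
by rewrite mulmxKV ?frame_unit.
Qed.

Definition finsler (R : realType) (x xi : 'rV[R]_6) : \bar R :=
  let eta := coords x xi in
  if [&& eta..[3] == 0, eta..[4] == 0, eta..[5] == 0 & eta..[6] == 0]
  then (Num.max `|eta..[1]| `|eta..[2]|)%:E
  else +oo%E.

Definition abs_continuous (R : realType) (V : normedModType R)
    (a b : R) (f : R -> V) : Prop :=
  forall e : R, 0 < e -> exists2 d : R, 0 < d &
    forall (n : nat) (s t : 'I_n -> R),
      (forall i, a <= s i /\ s i <= t i /\ t i <= b) ->
      trivIset [set: 'I_n] (fun i => `]s i, t i[%classic) ->
      \sum_(i < n) (t i - s i) < d ->
      \sum_(i < n) `|f (t i) - f (s i)| < e.

(* Curves are total functions of which only the restriction to `[a, b]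
   matters. *)
Definition joins (R : realType) (p q : 'rV[R]_6) (a b : R)
    (x : R -> 'rV[R]_6) : Prop :=
  [/\ a <= b, abs_continuous a b x, x a = p & x b = q].

(* [derive1 x t] is the velocity; it exists for almost every t when x is
   absolutely continuous. *)
Definition curve_length (R : realType) (a b : R) (x : R -> 'rV[R]_6) : \bar R :=
  (\int[lebesgue_measure]_(t in `[a, b]) finsler (x t) (derive1 x t))%E.

Definition shortest (R : realType) (p q : 'rV[R]_6) (a b : R)
    (x : R -> 'rV[R]_6) : Prop :=
  joins p q a b x /\
  forall (c d : R) (y : R -> 'rV[R]_6), joins p q c d y ->
    (curve_length a b x <= curve_length c d y)%E.

Definition natural_param (R : realType) (a b : R) (x : R -> 'rV[R]_6) : Prop :=
  {ae lebesgue_measure,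
    forall t : R, t \in `[a, b] -> finsler (x t) (derive1 x t) = 1%E}.

(* A path determines its natural parameterization up to a translation of the
   time, which is fixed by starting at 0. *)
Definition unique_shortest (R : realType) (p q : 'rV[R]_6) (T : R)
    (x : R -> 'rV[R]_6) : Prop :=
  [/\ shortest p q 0 T x,
      natural_param 0 T x &
      forall (S : R) (y : R -> 'rV[R]_6),
        shortest p q 0 S y -> natural_param 0 S y ->
        S = T /\ {in `[0, T], y =1 x}].

(* The pair (v, u) with x' = v g_1(x) + u g_2(x) for a horizontal curve. *)
Definition control (R : realType) (x : R -> 'rV[R]_6) (t : R) : R * R :=
  let eta := coords (x t) (derive1 x t) in (eta..[1], eta..[2]).

(* The control set is the square [-1, 1]^2. *)
Definition vertex (R : realType) (w : R * R) : Prop :=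
  `|w.1| = 1 /\ `|w.2| = 1.

Definition switch_time (R : realType) (T : R) (x : R -> 'rV[R]_6) (t : R) :
    Prop :=
  exists (w w' : R * R) (e : R),
    [/\ vertex w /\ vertex w', w != w',
        0 < e /\ 0 <= t - e /\ t + e <= T,
        {ae lebesgue_measure,
          forall s : R, s \in `]t - e, t[ -> control x s = w} &
        {ae lebesgue_measure,
          forall s : R, s \in `]t, t + e[ -> control x s = w'}].

Definition chattering (R : realType) (T : R) (x : R -> 'rV[R]_6) : Prop :=
  exists2 tau : R, tau \in `[0, T] &
    forall e : R, 0 < e ->
      ([set t : R | switch_time T x t /\ `|t - tau| < e] #= [set: nat])%card.

(* Main.v *)
Require Import Defs.
From HB Require Import structures.
From mathcomp Require Import all_boot all_order all_algebra.
From mathcomp Require Import all_classical all_reals all_analysis.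
From mathcomp Require Import measurable_realfun.
From mathcomp Require Import ring lra.

Set Implicit Arguments.
Unset Strict Implicit.
Unset Printing Implicit Defensive.

Import Order.TTheory GRing.Theory Num.Theory.
Import numFieldNormedType.Exports.

Local Open Scope classical_set_scope.
Local Open Scope ring_scope.

(** Along a curve with velocity [v *: g1 + u *: g2] the first coordinate moves
    with speed [v], and the norm of the velocity is at least [`|v|].  Hence a
    curve whose first coordinate grows by 1 has length at least 1, and if it is
    naturally parameterized and has length 1, then its first coordinate is the
    time, up to a constant.  For such curves
    [x2' = u], [x3' = - x2], [x4' = - x3], [x5' = - t * x3], [x6' = x3^2 / 2]
    with [`|u| <= 1].  So, the end values of [x2] and [x3] being prescribed,
    [x6] is the cost in Fuller's problem: minimize the integral of [x3^2] when
    the second derivative of [x3] is bounded by 1.  Its solutions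
    that come to rest at the origin switch infinitely often, and by strict
    convexity of the cost they are unique.  The required pair of points
    therefore consists of the ends of such a solution.

    The extremal is written down explicitly ([exists_fuller_extremal]).  In
    terms of the time to go [s = 1 - t] let [F0] satisfy
    [F0'''' = - sgn F0] and [F0 (q * s) = - q^4 * F0 s] for a ratio [q > 1].  On
    an interval between two zeros [F0] is a quartic polynomial; matching it
    with its rescaled copy at the end of the interval gives a linear system
    for its coefficients, which is solvable if and only if
    [q^4 - 3 * q^3 - 4 * q^2 - 3 * q + 1 = 0].  The derivatives [F1], [F2], [F3]
    of [F0] yield [x4], [x3], [x2], and the control is [u = sgn F0].

    Optimality and uniqueness come at once from one function
    ([extremal_unique]).  If [y] is a competitor and [h] is the difference
    of [y] and the extremal, put
    [Phi t = F0 (1 - t) * h2 t - F1 (1 - t) * h3 t - h6 t].  The derivative of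
    [Phi] is [F0 * (u_y - sgn F0) - h3^2 / 2], which is not positive, and [Phi]
    vanishes at both ends because [h] does.  So [Phi] is constant, [h3 = 0], and
    all the other coordinates of [h] follow.

    The curves are only absolutely continuous, so both arguments rest on the
    fundamental theorem of calculus for such functions
    ([abs_continuous_density]).  The total variation [V] of an absolutely
    continuous [f] is absolutely continuous too; therefore the Stieltjes
    measures of the nondecreasing functions [V] and [V - f] are dominated by the
    Lebesgue measure, and the difference of their Radon-Nikodym densities is
    almost everywhere the derivative of [f]. *)

(** * Families of non-overlapping intervals *)

Section families.
Context {R : realType}.
Implicit Types (a b : R) (p q : R * R) (L M : seq (R * R)) (f : R -> R).

(** The open intervals [`]p.1, p.2[] and [`]q.1, q.2[] are disjoint; see
    [nonoverlapP].  In this form the relation passes to subintervals and to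
    images under monotone maps. *)
Definition nonoverlap p q := Num.min p.2 q.2 <= Num.max p.1 q.1.

Definition subitv a b p := [&& a <= p.1, p.1 <= p.2 & p.2 <= b].

Definition nonoverlapping a b L := all (subitv a b) L && pairwise nonoverlap L.

Definition total_length L := \sum_(p <- L) (p.2 - p.1).

Definition total_increment f L := \sum_(p <- L) `|f p.2 - f p.1|.

Lemma total_length_cat L M :
  total_length (L ++ M) = total_length L + total_length M.
Proof. exact: big_cat. Qed.

Lemma total_increment_cat f L M :
  total_increment f (L ++ M) = total_increment f L + total_increment f M.
Proof. exact: big_cat. Qed.

Lemma nonoverlapC p q : nonoverlap p q = nonoverlap q p.
Proof. by rewrite /nonoverlap minC maxC. Qed.

Lemma nonoverlap_sub p p' q : nonoverlap p q ->
  p.1 <= p'.1 -> p'.2 <= p.2 -> nonoverlap p' q.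
Proof.
rewrite /nonoverlap => pq p1 p2.
rewrite (le_trans _ (le_trans pq _))//.
  by rewrite le_min !ge_min p2 lexx orbT.
by rewrite ge_max !le_max p1 lexx orbT.
Qed.

Lemma nonoverlapP p q :
  `]p.1, p.2[%classic `&` `]q.1, q.2[%classic = set0 <-> nonoverlap p q.
Proof.
rewrite /nonoverlap; split=> [|pq].
  apply: contraPT; rewrite -ltNge => pq.
  apply/eqP/set0P; exists ((Num.max p.1 q.1 + Num.min p.2 q.2) / 2).
  have [] : p.1 <= Num.max p.1 q.1 /\ q.1 <= Num.max p.1 q.1.
    by rewrite !le_max !lexx orbT.
  have [] : Num.min p.2 q.2 <= p.2 /\ Num.min p.2 q.2 <= q.2.
    by rewrite !ge_min !lexx orbT.
  move: pq; move: (Num.min _ _) (Num.max _ _) => v u uv v1 v2 u1 u2.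
  by split; rewrite /= in_itv/=; apply/andP; split; lra.
apply/seteqP; split=> // t [] /=; rewrite !in_itv/= => /andP[t1 t2] /andP[t3 t4].
suff: t < t by rewrite ltxx.
rewrite (@lt_le_trans _ _ (Num.min p.2 q.2)) ?lt_min ?t2//.
by rewrite (le_trans pq)// ltW// gt_max t1.
Qed.

Lemma abs_continuous_list a b f : abs_continuous a b f ->
  forall e, 0 < e -> exists2 d, 0 < d & forall L, nonoverlapping a b L ->
  total_length L < d -> total_increment f L < e.
Proof.
move=> acf e e0; have [d d0 H] := acf e e0; exists d => // L /andP[Lab Ldisj] Ld.
pose x0 : R * R := (0, 0).
have := H (size L) (fun i => (nth x0 L i).1) (fun i => (nth x0 L i).2).
rewrite /total_length (big_nth x0) big_mkord in Ld.
rewrite /total_increment (big_nth x0) big_mkord; apply => //.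
- move=> i; have /and3P[? ? ?] := allP Lab _ (mem_nth x0 (ltn_ord i)).
  by split=> //; split.
- apply/trivIsetP => i j _ _ ij; apply/nonoverlapP.
  wlog ltij : i j ij / (i < j)%N.
    move=> h; have := ij; rewrite -(inj_eq val_inj) neq_ltn => /orP[|/h]; first exact: h.
    by rewrite nonoverlapC; apply; rewrite eq_sym.
  by have /(pairwiseP x0) := Ldisj; apply => //; exact: ltn_ord.
Qed.

Lemma nonoverlapping_partition a b s : itv_partition a b s ->
  nonoverlapping a b (pairmap pair a s).
Proof.
elim: s a => [//|x s IH] a [/= /andP[ax xs] xb].
have xbs : itv_partition x b s by [].
have lexb := itv_partition_le xbs.
have /andP[sab sd] := IH x xbs.
rewrite /nonoverlapping/= sd andbT {1}/subitv/= lexx lexb (ltW ax)/=.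
have sx p : p \in pairmap pair x s -> x <= p.1 /\ subitv a b p.
  move=> /(allP sab)/and3P[? ? ?]; split => //.
  by apply/and3P; split => //; rewrite (le_trans (ltW ax)).
apply/andP; split; apply/allP => p /sx[]// xp _.
by rewrite /nonoverlap/= ge_min le_max xp orbT.
Qed.

Lemma total_length_partition a b s : itv_partition a b s ->
  total_length (pairmap pair a s) = b - a.
Proof.
rewrite /total_length.
elim: s a => [a /itv_partition_nil ->|x s IH a /= H]; first by rewrite big_nil subrr.
rewrite big_cons/= (IH x); first by rewrite addrC subrKA.
exact: itv_partition_cons H.
Qed.

Lemma total_increment_partition a b s f : itv_partition a b s ->
  total_increment f (pairmap pair a s) = variation a b f s.
Proof.
move=> abs; rewrite variation_zip// /total_increment.
elim: s a abs => [a _|x s IH a H]; first by rewrite !big_nil.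
rewrite /= !big_cons/= (IH x)//.
exact: itv_partition_cons H.
Qed.

(** Replacing an interval by a partition of it keeps the family non-overlapping
    and its total length.  The intervals are replaced one at a time, the others
    being either still to do ([L]) or already subdivided ([M]); so the suprema
    are taken one after the other. *)
Lemma sum_total_variation_le a b f d e :
  (forall L, nonoverlapping a b L -> total_length L < d ->
    total_increment f L <= e) ->
  forall L M, nonoverlapping a b (L ++ M) -> total_length (L ++ M) < d ->
  (\sum_(p <- L) total_variation p.1 p.2 f + (total_increment f M)%:E <= e%:E)%E.
Proof.
move=> H; elim=> [|p L IH] M; first by rewrite big_nil add0e lee_fin; exact: H.
rewrite /nonoverlapping cat_cons /= -andbA => /and4P[pab LMab pLM LMd].
rewrite [total_length _]big_cons => LMlt.
rewrite big_cons -addeA.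
have TV0 q : q \in L -> (0 <= total_variation q.1 q.2 f)%E.
  move=> qL; apply: total_variation_ge0.
  by have /(allP LMab)/and3P[] : q \in L ++ M by rewrite mem_cat qL.
set X := (\sum_(_ <- _) _ + _)%E.
have key s : itv_partition p.1 p.2 s ->
    ((variation p.1 p.2 f s)%:E + X <= e%:E)%E.
  move=> ps; have := IH (pairmap pair p.1 s ++ M).
  rewrite total_increment_cat (total_increment_partition _ ps) EFinD addeCA; apply.
    move: LMab LMd pLM; rewrite /nonoverlapping !all_cat !pairwise_cat.
    move=> /andP[Lab Mab] /and3P[LM Ld Md] /andP[/allP pL /allP pM].
    have /andP[/allP sab sd] := nonoverlapping_partition ps.
    rewrite Lab Mab Ld Md sd !allrel_catr LM !andbT/=; apply/and3P; split.
    - apply/allP => q /sab /and3P[? ? ?]; have /and3P[? ? ?] := pab.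
      by apply/and3P; split => //; lra.
    - apply/allrelP => q r /pL pq /sab /and3P[? ? ?].
      by rewrite nonoverlapC; exact: nonoverlap_sub pq _ _.
    - apply/allrelP => r q /sab /and3P[? ? ?] /pM pq.
      exact: nonoverlap_sub pq _ _.
  rewrite !total_length_cat (total_length_partition ps) addrCA.
  by rewrite -total_length_cat.
have Xfin : X \is a fin_num.
  have X0 : (0 <= X)%E.
    rewrite adde_ge0 ?lee_fin ?sumr_ge0//.
    by rewrite big_seq sume_ge0.
  rewrite ge0_fin_numE//.
  have [pp|pp] := eqVneq p.1 p.2.
    have /key : itv_partition p.1 p.2 [::] by split; rewrite //= pp.
    by rewrite variation_nil add0e => /le_lt_trans; apply; rewrite ltry.
  have /key : itv_partition p.1 p.2 [:: p.2].
    by apply: itv_partition1; rewrite lt_neqAle pp; case/and3P: pab.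
  move=> /(le_trans _) /le_lt_trans; apply; last exact: ltry.
  by rewrite leeDr// lee_fin variation_ge0.
rewrite -leeBrDr//; apply: ge_ereal_sup => _ [_ [s ps <-] <-].
by rewrite leeBrDr// key.
Qed.

End families.

(** * Stieltjes measures of absolutely continuous functions *)

Section domination.
Context {R : realType}.
Implicit Types (I U : set R) (G : cumulative R R).
Local Notation mu := (@lebesgue_measure R).

(** Openness excludes the end points, finite measure excludes the rays. *)
Lemma open_interval_endpoints I : open I -> is_interval I -> (mu I < +oo)%E ->
  exists s t : R, s <= t /\ I = `]s, t[%classic.
Proof.
move=> oI /is_intervalP II Ioo.
have [I0|/set0P Ineq0] := eqVneq I set0.
  by exists 0, 0; rewrite I0 set_itvoo0.
have iI : I = (I°)%classic by apply/esym/interior_id.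
have {II} : exists i : interval R, I = [set` i] by exists (Rhull I).
move=> [[[bs s|[]] [bt t|[]]] II]; rewrite II ?interior_itv in iI;
  try (by move: Ioo; rewrite II lebesgue_measure_itv/= ?ltNyr ?ltry).
- exists s, t; split; last by rewrite II.
  move: Ineq0 => [x]; rewrite II iI /= in_itv/= => /andP[sx xt].
  exact: ltW (lt_trans sx xt).
all: move: Ineq0 => [x]; rewrite II /= in_itv/= ?andbF//.
Qed.

Lemma lebesgue_stieltjes_measure_itvoc G (s t : R) : s <= t ->
  lebesgue_stieltjes_measure G `]s, t]%classic = (G t - G s)%:E.
Proof.
move=> st; rewrite /lebesgue_stieltjes_measure /measure_extension.
rewrite measurable_mu_extE/=; last exact: is_ocitv.
by rewrite wlength_itv_bnd.
Qed.

(** A null set lies in an open set of small measure, that is, in a disjoint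
    union of open intervals of small total length; the hypothesis bounds the
    Stieltjes measure of every finite part of this union. *)
Lemma lebesgue_stieltjes_dominated G :
  (forall e, 0 < e -> exists2 d, 0 < d & forall L,
     all (fun p : R * R => p.1 <= p.2) L -> pairwise nonoverlap L ->
     total_length L < d -> \sum_(p <- L) (G p.2 - G p.1) <= e) ->
  lebesgue_stieltjes_measure G `<< mu.
Proof.
move=> acG; apply/null_content_dominatesP => N mN N0.
apply/eqP; rewrite eq_le measure_ge0 andbT; apply/lee_addgt0Pr => e e0.
rewrite add0e; have [d d0 H] := acG e e0.
have [||U [oU NU UNd]] := @lebesgue_regularity_outer R N d mN; rewrite ?N0//.
have mU : measurable U by exact: open_measurable.
have {UNd} Ud : (mu U < d%:E)%E.
  rewrite (le_lt_trans _ UNd)// -[U in leLHS](setDUK NU).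
  by rewrite (le_trans (measureU2 _ _ _))// ?N0 ?add0e//; exact: measurableD.
apply: (@le_trans _ _ (lebesgue_stieltjes_measure G U)).
  by apply: le_measure; rewrite ?inE.
pose I := open_disjoint_itv oU.
have mI k : measurable (I k).
  by apply: open_measurable; exact: open_disjoint_itv_open.
have IU k : I k `<=` U.
  by rewrite (open_disjoint_itv_bigcup oU); exact: bigcup_sup.
have Ist k : exists p : R * R, p.1 <= p.2 /\ I k = `]p.1, p.2[%classic.
  have [||| s [t [st It]]] := @open_interval_endpoints (I k).
  - exact: open_disjoint_itv_open.
  - exact: open_disjoint_itv_is_interval.
  - apply: (@le_lt_trans _ _ (mu U)); last exact: lt_trans Ud (ltry d).
    by apply: le_measure; rewrite ?inE//; exact: mI.
  - by exists (s, t).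
have [p pI] := choice Ist.
rewrite (open_disjoint_itv_bigcup oU).
rewrite (@measure_bigcup _ _ _ (lebesgue_stieltjes_measure G) _ I)//=.
apply: lime_le; first exact: is_cvg_nneseries.
apply: nearW => n; pose L := [seq p k | k <- index_iota 0 n].
rewrite (eq_bigl xpredT) ?big_mkord => [|k]; last exact: in_setT.
apply: (@le_trans _ _ (\sum_(q <- L) (G q.2 - G q.1))%:E).
  rewrite /L big_map big_mkord -sumEFin.
  apply: lee_sum => k _; have [pk ->] := pI k.
  rewrite -lebesgue_stieltjes_measure_itvoc//.
  apply: le_measure; rewrite ?inE//=; try exact: measurable_itv.
  exact: subset_itv_oo_oc.
rewrite lee_fin; apply: H.
- by apply/allP => q /mapP[k _ ->]; have [] := pI k.
- rewrite pairwise_map; apply: (@sub_pairwise _ ltn); last first.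
    by rewrite -sorted_pairwise ?/index_iota ?iota_ltn_sorted//; exact: ltn_trans.
  move=> k l kl /=; apply/nonoverlapP.
  have [_ <-] := pI k; have [_ <-] := pI l.
  have /trivIsetP := @open_disjoint_itv_trivIset _ _ oU; apply => //.
  by rewrite ltn_eqF.
- rewrite -lte_fin (le_lt_trans _ Ud)//.
  rewrite /total_length /L big_map big_mkord -sumEFin.
  rewrite (eq_bigr (fun k : 'I_n => mu (I k))); last first.
    move=> k _; have [pk ->] := pI k; rewrite lebesgue_measure_itv/= lte_fin.
    by have [//|tp] := ltP; rewrite (@le_anti _ _ (p k).1 (p k).2) ?pk// subrr.
  rewrite -measure_semi_additive_ord//=; last 2 first.
  - apply/trivIsetP => i j _ _ ij.
    have /trivIsetP := @open_disjoint_itv_trivIset _ _ oU; apply => //.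
  - by apply: bigsetU_measurable => k _; exact: mI.
  + apply: le_measure; rewrite ?inE//.
      by apply: bigsetU_measurable => k _; exact: mI.
    by move=> x; rewrite -bigcup_mkord => -[k _] /IU.
  + by move=> k; exact: mI.
- by move=> k _; exact: mI.
- exact: open_disjoint_itv_trivIset.
Qed.

End domination.

(** * Densities of absolutely continuous functions *)

Section densities.
Context {R : realType}.
Implicit Types (a b : R) (f F g : R -> R).
Local Notation mu := (@lebesgue_measure R).

Let clamp a b x : R := Num.max a (Num.min x b).

Let clamp_itv a b x : a <= b -> a <= clamp a b x <= b.
Proof. by move=> ab; rewrite /clamp le_max lexx/= ge_max ab ge_min lexx orbT. Qed.

Let clamp_id a b x : a <= x <= b -> clamp a b x = x.
Proof. by move=> /andP[ax xb]; rewrite /clamp (min_idPl xb) (max_idPr ax). Qed.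

Let clamp_nd a b : {homo clamp a b : x y / x <= y}.
Proof. by move=> x y xy; rewrite /clamp le_max2// le_min2. Qed.

Let clamp_sub a b x y : a <= b -> x <= y -> clamp a b y - clamp a b x <= y - x.
Proof.
rewrite /clamp => ab xy; case: (leP x b) => xb; case: (leP y b) => yb;
  by do ?[case: (leP a) => ?]; lra.
Qed.

(** Extended by constants, [F] becomes the distribution function of a finite
    measure dominated by the Lebesgue measure, to which the Radon-Nikodym
    theorem applies. *)
Lemma nondecreasing_density a b F : a < b ->
  {in `[a, b] &, {homo F : x y / x <= y}} ->
  (forall e, 0 < e -> exists2 d, 0 < d & forall L, nonoverlapping a b L ->
    total_length L < d -> \sum_(p <- L) (F p.2 - F p.1) <= e) ->
  exists2 g : R -> R, mu.-integrable setT (EFin \o g) &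
    forall x, a <= x <= b -> F x - F a = \int[mu]_(t in `]a, x]) g t.
Proof.
move=> ltab ndF acF; have ab := ltW ltab.
pose G0 x := F (clamp a b x).
have G0nd : {homo G0 : x y / x <= y}.
  by move=> x y xy; apply: ndF; rewrite ?in_itv/= ?clamp_itv//; exact: clamp_nd.
have G0ac e : 0 < e -> exists2 d, 0 < d & forall L,
     all (fun p : R * R => p.1 <= p.2) L -> pairwise nonoverlap L ->
     total_length L < d -> \sum_(p <- L) (G0 p.2 - G0 p.1) <= e.
  move=> /acF[d d0 H]; exists d => // L L12 Ldisj Ld.
  have := H [seq (clamp a b p.1, clamp a b p.2) | p <- L].
  rewrite big_map; apply.
  - apply/andP; split.
      apply/allP => _ /mapP[p /(allP L12)/= p12 ->].
      have /andP[? ?] := clamp_itv p.1 ab; have /andP[? ?] := clamp_itv p.2 ab.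
      by apply/and3P; split => //; exact: clamp_nd.
    rewrite pairwise_map; apply: sub_pairwise Ldisj => p q /=.
    rewrite /nonoverlap /= => /(clamp_nd a b).
    have cm u v : clamp a b (Num.min u v) = Num.min (clamp a b u) (clamp a b v).
      by case: (leP u v) => [uv|/ltW vu]; [rewrite (min_idPl _)|rewrite (min_idPr _)] => //;
        exact: clamp_nd.
    have cM u v : clamp a b (Num.max u v) = Num.max (clamp a b u) (clamp a b v).
      by case: (leP u v) => [uv|/ltW vu]; [rewrite (max_idPr _)|rewrite (max_idPl _)] => //;
        exact: clamp_nd.
    by rewrite cm cM.
  - rewrite (le_lt_trans _ Ld)// /total_length big_map/=.
    rewrite big_seq [leRHS]big_seq; apply: ler_sum => p /(allP L12).
    exact: clamp_sub.
have G0rc x : G0 @ x^'+ --> G0 x.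
  apply/cvgrPdist_le => e /G0ac[d d0 H].
  have xd : x < x + d by rewrite ltrDl.
  near=> y.
  have xy : x <= y by near: y; exact: nbhs_right_ge.
  rewrite distrC ger0_norm ?subr_ge0 ?G0nd//.
  have := H [:: (x, y)]; rewrite /total_length !big_seq1/=; apply => //.
    by rewrite andbT.
  by rewrite ltrBlDl; near: y; exact: nbhs_right_lt.
pose G : cumulative R R := HB.pack G0 (isCumulative.Build R _ R G0 G0nd G0rc).
have Gdom := lebesgue_stieltjes_dominated (G0ac : forall e, 0 < e ->
  exists2 d, 0 < d & forall L, all (fun p : R * R => p.1 <= p.2) L ->
   pairwise nonoverlap L ->
     total_length L < d -> \sum_(p <- L) (G p.2 - G p.1) <= e).
have mab : @measurable _ (measurableTypeR R) `]a, b]%classic.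
  exact: measurable_itv.
have Gfin : (lebesgue_stieltjes_measure G `]a, b]%classic < +oo)%E.
  by rewrite lebesgue_stieltjes_measure_itvoc// ltry.
have [|g [g0 gfin gint gE]] := @radon_nikodym_sigma_finite _ _ _ mu
    (mfrestr mab Gfin).
  apply/null_content_dominatesP => A mA A0; rewrite /mfrestr/= /mrestr.
  move/null_content_dominatesP : Gdom; apply; first exact: measurableI.
  by apply: subset_measure0 A0 => //; exact: measurableI.
have gK : EFin \o (fine \o g) = g.
  by apply/funext => x /=; rewrite fineK.
exists (fine \o g); first by rewrite gK.
move=> x /andP[ax xb].
have : (lebesgue_stieltjes_measure G (`]a, x]%classic `&` `]a, b]%classic) =
  \int[mu]_(t in `]a, x]) g t)%E by apply: gE; exact: measurable_itv.
rewrite setIidl; last exact: subset_itvl.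
rewrite lebesgue_stieltjes_measure_itvoc//.
rewrite /G/= /G0 !clamp_id ?lexx ?ax ?ab// => gI.
by rewrite /Rintegral -[LHS]/(fine (F x - F a)%:E) gI; congr (fine _);
  apply: eq_integral => t _ /=; rewrite fineK.
Unshelve. all: by end_near. Qed.

(** Finiteness: if [d] is the modulus for [e = 1], every interval of length
    [d / 2] carries variation at most 1, and finitely many of them cover
    [[a, b]]. *)
Lemma abs_continuous_total_variation a b f : a < b -> abs_continuous a b f ->
  (forall x, a <= x <= b -> total_variation a x f \is a fin_num) /\
  (forall e, 0 < e -> exists2 d, 0 < d & forall L, nonoverlapping a b L ->
    total_length L < d ->
    (\sum_(p <- L) total_variation p.1 p.2 f <= e%:E)%E).
Proof.
move=> ltab acf.
have key e : 0 < e -> exists2 d, 0 < d & forall L, nonoverlapping a b L ->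
    total_length L < d ->
    (\sum_(p <- L) total_variation p.1 p.2 f <= e%:E)%E.
  move=> /(abs_continuous_list acf)[d d0 H]; exists d => // L Lab Ld.
  have := @sum_total_variation_le _ a b f d e _ L [::].
  rewrite cats0 /total_increment big_nil adde0; apply => // L' L'ab L'd.
  exact/ltW/H.
split => // x /andP[ax xb].
have [d d0 H] := key 1 ltr01.
suff: forall k x, a <= x <= b -> x <= a + k%:R * (d / 2) ->
    (total_variation a x f < +oo)%E.
  move=> /(_ (Num.truncn ((x - a) / (d / 2))).+1 x); rewrite ax xb => /(_ isT).
  rewrite ge0_fin_numE ?total_variation_ge0//; apply.
  rewrite -lerBlDl -ler_pdivrMr ?divr_gt0// ltW//.
  by rewrite truncnS_gt.
elim=> [|k IH] {ax xb}x /andP[ax xb] xk.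
  have -> : x = a by apply/le_anti; rewrite ax andbT; lra.
  by rewrite total_variationxx ltry.
have [xk'|kx] := leP x (a + k%:R * (d / 2)); first by apply: IH; rewrite ?ax.
have kd : 0 <= k%:R * (d / 2) by rewrite mulr_ge0// divr_ge0// ltW.
have [ay yx] : a <= a + k%:R * (d / 2) /\ a + k%:R * (d / 2) <= x by split; lra.
rewrite (total_variationD f ay yx).
rewrite lte_add_pinfty//; first by apply: IH => //; apply/andP; split; lra.
have := H [:: (a + k%:R * (d / 2), x)]; rewrite big_seq1/= => TV1.
rewrite (le_lt_trans (TV1 _ _)) ?ltry//.
  rewrite /nonoverlapping/= /subitv/= !andbT; apply/and3P; split => //; lra.
rewrite /total_length big_seq1/=; move: xk; rewrite -natr1 mulrDl mul1r.
by move: (k%:R * (d / 2)) => m; lra.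
Qed.

(** [f] is the difference of the nondecreasing functions [V] and [V - f], where
    [V] is its variation; both inherit absolute continuity. *)
Theorem abs_continuous_density a b f : a < b -> abs_continuous a b f ->
  exists g : R -> R, [/\ mu.-integrable setT (EFin \o g),
    forall x, a <= x <= b -> f x - f a = \int[mu]_(t in `]a, x]) g t &
    {ae mu, forall x, a < x < b -> is_derive x 1 f (g x)}].
Proof.
move=> ltab acf; have ab := ltW ltab.
have [TVfin TVac] := abs_continuous_total_variation ltab acf.
pose V x := fine (total_variation a x f).
have VE s t : a <= s -> s <= t -> t <= b ->
    (V t - V s)%:E = total_variation s t f.
  move=> as_ st tb; rewrite EFinB !fineK ?TVfin ?as_ ?(le_trans st)//; last first.
    by rewrite (le_trans as_).
  rewrite (@total_variationD _ a t s)// addeAC subee ?add0e// TVfin// as_.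
  exact: le_trans tb.
have fV s t : a <= s -> s <= t -> t <= b -> `|f t - f s| <= V t - V s.
  by move=> as_ st tb; rewrite -lee_fin VE// total_variation_ge.
have Vac e : 0 < e -> exists2 d, 0 < d & forall L, nonoverlapping a b L ->
    total_length L < d -> \sum_(p <- L) (V p.2 - V p.1) <= e.
  move=> /TVac[d d0 H]; exists d => // L Lab /(H _ Lab).
  rewrite -lee_fin; apply: le_trans; rewrite -sumEFin.
  rewrite big_seq [leRHS]big_seq; apply: lee_sum => p pL.
  by have /andP[/allP /(_ _ pL)/and3P[? ? ?] _] := Lab; rewrite VE.
have [||g1 g1int g1E] := @nondecreasing_density a b V ltab.
- move=> s t; rewrite !in_itv/= => /andP[as_ _] /andP[_ tb] st.
  by rewrite -subr_ge0 (le_trans _ (fV _ _ _ _ _)).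
- exact: Vac.
have [||g2 g2int g2E] := @nondecreasing_density a b (fun x => V x - f x) ltab.
- move=> s t; rewrite !in_itv/= => /andP[as_ _] /andP[_ tb] st.
  by have := fV s t as_ st tb; rewrite ler_norml => /andP[]; lra.
- move=> e e0; have [|d d0 H] := Vac (e / 2); first by rewrite divr_gt0.
  exists d => // L Lab /(H _ Lab) He.
  apply: (@le_trans _ _ (\sum_(p <- L) 2 * (V p.2 - V p.1))); last first.
    by rewrite -mulr_sumr; lra.
  rewrite big_seq [leRHS]big_seq; apply: ler_sum => p pL.
  have /andP[/allP /(_ _ pL)/and3P[? ? ?] _] := Lab.
  by have := @fV p.1 p.2; rewrite ler_norml => /(_ _ _ _)/andP[]; lra.
pose g x := g1 x - g2 x.
have gint : mu.-integrable setT (EFin \o g).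
  have := integrableB measurableT g1int g2int.
  by apply: eq_integrable => // x _; rewrite /= EFinB.
have gE x : a <= x <= b -> f x - f a = \int[mu]_(t in `]a, x]) g t.
  move=> axb; rewrite /g RintegralB//=.
  - by rewrite -g1E// -g2E//; lra.
  - exact: integrableS g1int.
  - exact: integrableS g2int.
exists g; split=> //.
have := @FTC1 _ g (BRight a) _ (open_integrable_locally openT gint).
have gS y : mu.-integrable `]a, y]%classic (EFin \o g) by exact: integrableS gint.
move=> /(_ gS).
apply: filterS; first exact: (ae_filter_ringOfSetsType mu).
move=> x H /andP[ax xb].
have [|dF F1] := H; first exact: ax.
apply: (@near_eq_is_derive _ _ _ (fun y => f a + \int[mu]_(t in `]a, y]) g t)).
  have xab : x \in `]a, b[ by rewrite in_itv/= ax xb.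
  apply: filterS (near_in_itvoo xab) => y; rewrite in_itv/= => /andP[ay yb].
  have fy : f y - f a = \int[mu]_(t in `]a, y]) g t by apply: gE; rewrite !ltW.
  by rewrite -fy addrC subrK.
have ca : is_derive x 1 (cst (f a) : R -> R) 0 by exact: is_derive_cst.
have dg : is_derive x 1 (fun y => \int[mu]_(t in `]a, y]) g t) (g x).
  by rewrite -F1 derive1E; exact: DeriveDef.
by have := is_deriveD ca dg; rewrite add0r.
Qed.

End densities.

(** * Integrals of functions that need not be measurable *)

#[global] Instance lebesgue_ae_filter (R : realType) :
  Filter (nbhs (almost_everywhere (@lebesgue_measure R))).
Proof. exact: ae_filter_ringOfSetsType. Qed.

Section lower_integral.
Local Open Scope ereal_scope.
Context d (T : measurableType d) (R : realType).
Variable mu : {measure set T -> \bar R}.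
Import HBNNSimple.

(** For nonnegative functions the integral is a supremum over simple functions
    below the integrand, and a simple function can be set to zero on a null
    set; so the comparison holds for arbitrary integrands.  It is meant for the
    norm of the velocity of a curve, which is known only up to a null set. *)
Lemma ge0_ae_le_integral (D : set T) (f1 f2 : T -> \bar R) :
  (forall x, D x -> 0 <= f1 x) -> (forall x, D x -> 0 <= f2 x) ->
  {ae mu, forall x, D x -> f1 x <= f2 x} ->
  \int[mu]_(x in D) f1 x <= \int[mu]_(x in D) f2 x.
Proof.
move=> f10 f20 [N [mN N0 fN]]; rewrite !ge0_integralE//.
apply: ge_ereal_sup => _ [h /= hf1 <-].
have [h' h'E] : exists h' : {nnsfun T >-> R},
    forall x, h' x = (h x * (x \notin N)%:R)%R.
  exists (mul_nnsfun h (indic_nnsfun R (measurableC mN))) => x /=.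
  by rewrite mindicE in_setC.
apply: ereal_sup_ubound; exists h' => /=.
  move=> x; rewrite h'E; have [xN|xN] := boolP (x \in N); rewrite ?mulr0 ?mulr1.
    by rewrite patchE; case: ifPn => // /set_mem/f20.
  rewrite (le_trans (hf1 x))// !patchE; case: ifPn => // /set_mem Dx.
  have := xN; rewrite notin_setE => /(contra_not (fN x))/contrapT; exact.
rewrite -!integralT_nnsfun; apply: ge0_ae_eq_integral => //.
- by apply/measurable_EFinP.
- by apply/measurable_EFinP.
- by move=> x _; rewrite lee_fin.
- by move=> x _; rewrite lee_fin.
- exists N; split => // x; apply: contra_notP => xN _.
  by rewrite h'E (_ : x \notin N) ?mulr1// notin_setE.
Qed.

Lemma ge0_ae_eq_cst_integral (D : set T) (f : T -> \bar R) (c : R) :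
  measurable D -> (0 <= c)%R -> (forall x, D x -> 0 <= f x) ->
  {ae mu, forall x, D x -> f x = c%:E} ->
  \int[mu]_(x in D) f x = c%:E * mu D.
Proof.
move=> mD c0 f0 fc; rewrite -(integral_cst _ mD c%:E); apply/eqP.
rewrite eq_le; apply/andP; split; apply: ge0_ae_le_integral => //=.
- by apply: filterS fc => x fc /fc ->.
- by apply: filterS fc => x fc /fc ->.
Qed.

End lower_integral.

Lemma ae_itv_exists (R : realType) (a b : R) (P : R -> Prop) : a < b ->
  {ae @lebesgue_measure R, forall s : R, s \in `]a, b[ -> P s} ->
  exists s, a < s < b /\ P s.
Proof.
move=> ab [N [mN N0 PN]]; apply: contrapT => nP.
have abN : `]a, b[%classic `<=` N.
  move=> s /= sab; apply: PN => /= /(_ sab) Ps; apply: nP; exists s.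
  by move: sab; rewrite in_itv.
have mab : @measurable _ (measurableTypeR R) `]a, b[%classic.
  exact: measurable_itv.
have := subset_measure0 mab mN abN N0.
by rewrite [X in X = _]lebesgue_measure_itv/= lte_fin ab -EFinB => -[]; lra.
Qed.

(** * Calculus with absolutely continuous functions *)

Section abs_continuous_closure.
Context {R : realType}.
Implicit Types (a b c d : R).

Lemma abs_continuousS (V : normedModType R) a b c d (f : R -> V) :
  a <= c -> d <= b -> abs_continuous a b f -> abs_continuous c d f.
Proof.
move=> ac db acf e /acf[r r0 H]; exists r => // n s t stcd; apply: H => i.
have [? [? ?]] := stcd i.
by split; [exact: le_trans ac _|split => //; exact: le_trans db].
Qed.

Lemma lipschitz_abs_continuous (V : normedModType R) a b (f : R -> V) (K : R) :
  (forall s t, a <= s -> s <= t -> t <= b -> `|f t - f s| <= K * (t - s)) ->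
  abs_continuous a b f.
Proof.
move=> Kf e e0; pose K1 := `|K| + 1.
have K10 : 0 < K1 by rewrite ltr_wpDl.
exists (e / K1); first exact: divr_gt0.
move=> n s t stab _; rewrite ltr_pdivlMr// mulrC => /le_lt_trans; apply.
rewrite mulr_sumr; apply: ler_sum => i _; have [as_ [st tb]] := stab i.
rewrite (le_trans (Kf _ _ as_ st tb))// ler_wpM2r ?subr_ge0//.
by rewrite (le_trans (ler_norm K))// lerDl.
Qed.

Lemma abs_continuousD (V : normedModType R) a b (f g : R -> V) :
  abs_continuous a b f -> abs_continuous a b g ->
  abs_continuous a b (fun t => f t + g t).
Proof.
move=> acf acg e e0; have e20 : 0 < e / 2 by rewrite divr_gt0.
have [d1 d10 H1] := acf _ e20; have [d2 d20 H2] := acg _ e20.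
exists (Num.min d1 d2); first by rewrite lt_min d10.
move=> n s t stab st; rewrite lt_min => /andP[l1 l2].
rewrite [ltRHS]splitr (le_lt_trans _ (ltrD (H1 _ _ _ stab st l1) (H2 _ _ _ stab st l2)))//.
by rewrite -big_split/= ler_sum// => i _; rewrite opprD addrACA ler_normD.
Qed.

Lemma abs_continuousN (V : normedModType R) a b (f : R -> V) :
  abs_continuous a b f -> abs_continuous a b (fun t => - f t).
Proof.
move=> acf e /acf[d d0 H]; exists d => // n s t stab st /(H _ _ _ stab st).
by congr (_ < _); apply: eq_bigr => i _; rewrite -opprD normrN.
Qed.

Lemma abs_continuousB (V : normedModType R) a b (f g : R -> V) :
  abs_continuous a b f -> abs_continuous a b g ->
  abs_continuous a b (fun t => f t - g t).
Proof. by move=> acf acg; apply: abs_continuousD => //; exact: abs_continuousN. Qed.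

Lemma abs_continuous_bounded a b (f : R -> R) : a < b -> abs_continuous a b f ->
  exists2 M, 0 < M & forall t, a <= t <= b -> `|f t| <= M.
Proof.
move=> ab acf; have [TVfin _] := abs_continuous_total_variation ab acf.
exists (`|f a| + fine (total_variation a b f) + 1).
  rewrite ltr_wpDl// addr_ge0// fine_ge0// total_variation_ge0//; exact: ltW.
move=> t /andP[at_ tb]; rewrite -[f t](subrK (f a)) (le_trans (ler_normD _ _))//.
rewrite addrC -addrA lerD2l ler_wpDr// -lee_fin fineK ?TVfin ?lexx ?(ltW ab)//.
rewrite (@total_variationD _ a b t)//.
by rewrite (le_trans (total_variation_ge f at_))// leeDl// total_variation_ge0.
Qed.

Lemma abs_continuousM a b (f g : R -> R) : a < b ->
  abs_continuous a b f -> abs_continuous a b g ->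
  abs_continuous a b (fun t => f t * g t).
Proof.
move=> ab acf acg; have [M M0 fM] := abs_continuous_bounded ab acf.
have [K K0 gK] := abs_continuous_bounded ab acg => e e0.
have [|d1 d10 H1] := acf (e / (2 * K)); first by rewrite divr_gt0// mulr_gt0.
have [|d2 d20 H2] := acg (e / (2 * M)); first by rewrite divr_gt0// mulr_gt0.
exists (Num.min d1 d2); first by rewrite lt_min d10.
move=> n s t stab st; rewrite lt_min => /andP[l1 l2].
have {}H1 := H1 _ _ _ stab st l1; have {}H2 := H2 _ _ _ stab st l2.
have {}H1 : K * \sum_(i < n) `|f (t i) - f (s i)| < e / 2.
  by rewrite mulrC -ltr_pdivlMr// -mulrA -invfM.
have {}H2 : M * \sum_(i < n) `|g (t i) - g (s i)| < e / 2.
  by rewrite mulrC -ltr_pdivlMr// -mulrA -invfM.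
rewrite [ltRHS]splitr (le_lt_trans _ (ltrD H1 H2))//.
rewrite !mulr_sumr -big_split/= ler_sum// => i _.
have [as_ [sti tb]] := stab i.
have -> : f (t i) * g (t i) - f (s i) * g (s i) =
  g (t i) * (f (t i) - f (s i)) + f (s i) * (g (t i) - g (s i)) by ring.
rewrite (le_trans (ler_normD _ _))// !normrM lerD// ler_wpM2r//.
  by rewrite gK// tb (le_trans as_).
by rewrite fM// as_ (le_trans sti).
Qed.

Lemma abs_continuous_coord m n a b (f : R -> 'M[R]_(m.+1, n.+1)) i j :
  abs_continuous a b f -> abs_continuous a b (fun t => f t i j).
Proof.
move=> acf e /acf[d d0 H]; exists d => // k s t stab st /(H _ _ _ stab st).
apply: le_lt_trans; apply: ler_sum => l _.
rewrite [leRHS]/Num.Def.normr/= mx_normrE.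
by apply: le_trans; last exact: (le_bigmax _ _ (i, j)); rewrite !mxE.
Qed.

End abs_continuous_closure.

Section abs_continuous_derivative.
Context {R : realType}.
Implicit Types (a b : R) (f : R -> R).
Local Notation mu := (@lebesgue_measure R).

Lemma abs_continuous_ae_derivable a b f : a < b -> abs_continuous a b f ->
  {ae mu, forall x, a < x < b -> derivable f x 1}.
Proof.
move=> ab /(abs_continuous_density ab)[g [_ _]].
apply: filterS.
by move=> x H /H[].
Qed.

(** The form of the fundamental theorem used for lengths: [h] stands for the
    norm of the velocity. *)
Lemma abs_continuous_le_length a b f (h : R -> \bar R) : a <= b ->
  abs_continuous a b f -> (forall x, (0 <= h x)%E) ->
  {ae mu, forall x, a < x < b ->
    forall l, is_derive x 1 f l -> (`|l|%:E <= h x)%E} ->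
  ((f b - f a)%:E <= \int[mu]_(x in `[a, b]) h x)%E.
Proof.
rewrite le_eqVlt => /predU1P[<-|ab] acf h0 hf.
  by rewrite subrr integral_ge0.
have [g [gint gE gder]] := abs_continuous_density ab acf.
have mab : @measurable _ (measurableTypeR R) `]a, b[%classic.
  exact: measurable_itv.
have gab : mu.-integrable `]a, b[ (EFin \o g) by exact: integrableS gint.
have -> : (f b - f a)%:E = (\int[mu]_(x in `]a, b[) (g x)%:E)%E.
  have gab' : mu.-integrable `]a, b] (EFin \o g) by exact: integrableS gint.
  rewrite gE ?lexx ?(ltW ab)// -Rintegral_itv_bndo_bndc//.
  by rewrite /Rintegral fineK// integrable_fin_num.
apply: (@le_trans _ _ (\int[mu]_(x in `]a, b[) `|(g x)%:E|)%E).
  apply: (le_trans (lee_abs _)); apply: le_abse_integral => //.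
  exact: measurable_int gab.
rewrite integral_mkcond [leRHS]integral_mkcond.
apply: ge0_ae_le_integral => [x _|x _|].
- by rewrite patchE; case: ifP.
- by rewrite patchE; case: ifP.
have : {ae mu, forall x, a < x < b -> (`|(g x)%:E| <= h x)%E}.
  by apply: filterS2 gder hf => x gx hx axb; apply: hx => //; exact: gx.
apply: filterS.
move=> x gh _; rewrite !patchE; case: ifPn => [|_]; last by case: ifP.
rewrite inE/= in_itv/= => /[dup] axb /gh ghx.
by rewrite ifT// inE/= in_itv/=; case/andP: axb => /ltW-> /ltW->.
Qed.

Lemma abs_continuous_nonincreasing a b f : a <= b -> abs_continuous a b f ->
  {ae mu, forall x, a < x < b -> exists2 l, is_derive x 1 f l & l <= 0} ->
  f b <= f a.
Proof.
rewrite le_eqVlt => /predU1P[<-//|ab] acf f0.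
have [g [gint gE gder]] := abs_continuous_density ab acf.
have mab : @measurable _ (measurableTypeR R) `]a, b[%classic.
  exact: measurable_itv.
have gab : mu.-integrable `]a, b[ (EFin \o g) by exact: integrableS gint.
rewrite -subr_le0 gE ?lexx ?(ltW ab)// -Rintegral_itv_bndo_bndc//.
have mg : measurable_fun `]a, b[ (EFin \o g) by exact: measurable_int gab.
rewrite /Rintegral -lee_fin fineK; last by rewrite integrable_fin_num.
rewrite (@ae_eq_integral _ _ _ mu _ (fun x => - `|(g x)%:E|)%E)//.
- by rewrite (integral_ge0N _ (fun x _ => abse_ge0 _)) oppe_le0 integral_ge0.
- have mag : measurable_fun `]a, b[ (abse \o (EFin \o g)).
    apply: measurableT_comp => //.
  by apply: (measurableT_comp _ mag).
have : {ae mu, forall x, a < x < b -> g x <= 0}.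
  apply: filterS2 gder f0 => x gx fx axb; have [l dl l0] := fx axb.
  by have [_ <-] := gx axb; have [_ ->] := dl.
apply: filterS.
move=> x gx; rewrite /= in_itv/= => /gx gx0.
by rewrite ler0_norm// opprK.
Qed.

Lemma abs_continuous_constant a b f : abs_continuous a b f ->
  {ae mu, forall x, a < x < b -> is_derive x 1 f 0} ->
  forall x, a <= x <= b -> f x = f a.
Proof.
move=> acf f0 x /andP[ax xb]; have acx := abs_continuousS (lexx a) xb acf.
have xbS y : a < y < x -> a < y < b.
  by move=> /andP[-> /lt_le_trans->].
apply/eqP; rewrite eq_le -[f a <= _]lerN2; apply/andP; split.
  apply: abs_continuous_nonincreasing => //.
  by apply: filterS f0 => y f0 /xbS/f0; exists 0.
apply: (@abs_continuous_nonincreasing a x (fun t => - f t)) => //.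
  exact: abs_continuousN.
apply: filterS f0 => y f0 /xbS/f0 dy; exists 0 => //.
by rewrite -oppr0; exact: is_deriveN.
Qed.

(** The square of [f] has derivative [2 * f * f' = 0] almost everywhere, hence is
    constant. *)
Lemma abs_continuous_ae0 (f : R -> R) (a b : R) : a < b -> abs_continuous a b f ->
  f a = 0 -> {ae @lebesgue_measure R, forall t, a < t < b -> f t = 0} ->
  forall t, a <= t <= b -> f t = 0.
Proof.
move=> ab acf fa f0 t tab.
have : f t * f t = f a * f a.
  apply: (abs_continuous_constant (abs_continuousM ab acf acf)) => //.
  apply: filterS2 f0 (abs_continuous_ae_derivable ab acf) => s fs0 dfs sab.
  have ds : is_derive s (1 : R) f ('D_1 f s) by apply: DeriveDef => //; exact: dfs.
  have := is_deriveM ds ds; rewrite fs0// /GRing.scale/= !mul0r addr0.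
  by [].
by rewrite fa mulr0 => /eqP; rewrite mulf_eq0 orbb => /eqP.
Qed.

Lemma is_derive_local_cst (f : R -> R) (a b t c l : R) : a < t < b ->
  (forall s, a < s < b -> f s = c) -> is_derive t (1 : R) f l -> l = 0.
Proof.
move=> tab fc [_ <-].
have tI : t \in `]a, b[ by rewrite in_itv.
rewrite (@near_eq_derive _ _ _ _ (cst c)) ?derive_cst//.
by apply: filterS (near_in_itvoo tI) => s; rewrite in_itv/= => /fc.
Qed.

End abs_continuous_derivative.

(** * Functions invariant under a discrete scaling *)

Section self_similar.
Context {R : realType}.
Variable q : R.
Hypothesis q2 : 2 <= q.
Implicit Types (f : R -> R) (rho s t : R) (k : nat).

Let q0 : 0 < q. Proof. by rewrite (lt_le_trans _ q2). Qed.
Let q1 : 1 < q. Proof. by rewrite (lt_le_trans _ q2)// ltr1n. Qed.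
Let qk0 k : 0 < q ^- k. Proof. by rewrite invr_gt0 exprn_gt0. Qed.

(** The index [k] with [q^-(k+1) < s <= q^-k], which exists for [0 < s <= 1]. *)
Definition scale s : nat := xget 0%N [set k | q ^- k.+1 < s <= q ^- k].

(** On [(0, 1]], the continuation of [f], taken on [(1, q]], by the rule
    [F (s / q) = F s / rho]. *)
Definition selfsim rho f s : R :=
  if 0 < s then rho ^- (scale s).+1 * f (q ^+ (scale s).+1 * s) else 0.

Let qnS k : q ^- k.+1 < q ^- k.
Proof. by rewrite ltf_pV2 ?posrE ?exprn_gt0// ltr_eXn2l. Qed.

Lemma exists_expVn_lt s : 0 < s -> exists k, q ^- k < s.
Proof.
move=> s0; exists (Num.truncn s^-1).+1.
rewrite invf_plt ?posrE ?exprn_gt0//; apply: lt_le_trans (truncnS_gt _) _.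
apply: (@le_trans _ _ (2 ^+ (Num.truncn s^-1).+1)).
  by rewrite -natrX ler_nat ltnW// ltn_expl.
by rewrite lerXn2r// nnegrE// ltW.
Qed.

Lemma exists_scale s : 0 < s -> s <= 1 -> exists k, q ^- k.+1 < s <= q ^- k.
Proof.
move=> s0 s1; pose P k := q ^- k < s.
have exP : exists k, P k by exact: exists_expVn_lt.
case: (ex_minnP exP) => -[|k] Pk kmin.
  by move: Pk; rewrite /P expr0 invr1 ltNge s1.
exists k; rewrite [_ < s]Pk leNgt; apply/negP => /kmin; by rewrite ltnn.
Qed.

Lemma scaleE s k : q ^- k.+1 < s <= q ^- k -> scale s = k.
Proof.
move=> /andP[ks sk]; rewrite /scale; case: xgetP => [j _ /andP[js sj]|]; last first.
  by move=> /(_ k)/=; rewrite ks sk => /(_ isT).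
have lt_exp i l : q ^- i.+1 < q ^- l -> (l <= i)%N.
  by rewrite ltf_pV2 ?posrE ?exprn_gt0// ltr_eXn2l.
apply/eqP; rewrite eqn_leq; apply/andP; split; apply: lt_exp.
  exact: lt_le_trans ks sj.
exact: lt_le_trans js sk.
Qed.

Lemma selfsim_open rho f s k : q ^- k.+1 < s <= q ^- k ->
  selfsim rho f s = rho ^- k.+1 * f (q ^+ k.+1 * s).
Proof.
move=> sk; rewrite /selfsim (scaleE sk) ifT//.
by case/andP: sk => + _; exact: lt_trans.
Qed.

(** The matching condition [f q = rho * f 1] makes the formula valid at the left
    end of the interval as well. *)
Lemma selfsim_piece rho f s k : rho != 0 -> f q = rho * f 1 ->
  q ^- k.+1 <= s <= q ^- k -> selfsim rho f s = rho ^- k.+1 * f (q ^+ k.+1 * s).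
Proof.
move=> rho0 fq /andP[]; rewrite le_eqVlt => /predU1P[<- _|ks sk]; last first.
  by apply: selfsim_open; rewrite ks.
rewrite (@selfsim_open _ _ _ k.+1); last by rewrite qnS lexx.
rewrite mulfV ?gt_eqF ?exprn_gt0//.
rewrite (exprS q) -mulrA mulfV ?gt_eqF ?exprn_gt0// mulr1 fq.
by rewrite [rho ^+ k.+2]exprS invfM mulrA [_^-1 * _ * rho]mulrAC mulVf// mul1r.
Qed.

Lemma selfsim0 rho f s : s <= 0 -> selfsim rho f s = 0.
Proof. by rewrite /selfsim leNgt => /negbTE ->. Qed.

(** On the interval of index [k] the slope of [f] is multiplied by
    [q^(k+1) / rho^(k+1)], which is at most 1 in absolute value; and
    [`|selfsim s| <= K * q^-(k+1) <= K * s] gives the estimate at 0. *)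
Lemma selfsim_lipschitz rho f K : q <= `|rho| -> f q = rho * f 1 ->
  (forall s t, 1 <= s -> s <= t -> t <= q -> `|f t - f s| <= K * (t - s)) ->
  (forall s, 1 <= s <= q -> `|f s| <= K) ->
  forall s t, 0 <= s -> s <= t -> t <= 1 ->
  `|selfsim rho f t - selfsim rho f s| <= K * (t - s).
Proof.
move=> qrho fq Lf bf; set F := selfsim rho f.
have K0 : 0 <= K by apply: le_trans (bf 1 _); rewrite ?lexx//= ltW.
have rho0 : rho != 0 by rewrite -normr_gt0 (lt_le_trans q0).
have FE := selfsim_piece rho0 fq.
have rhoq k : `|rho| ^- k <= q ^- k.
  by rewrite lef_pV2 ?posrE ?exprn_gt0 ?normr_gt0// lerXn2r// nnegrE ltW.
have scaled k s : q ^- k.+1 <= s <= q ^- k -> 1 <= q ^+ k.+1 * s <= q.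
  move=> /andP[ks sk]; rewrite -ler_pdivrMl ?exprn_gt0// mulr1 ks/=.
  by rewrite -ler_pdivlMl ?exprn_gt0// exprSr invfM mulfVK ?gt_eqF.
have piece k s t : q ^- k.+1 <= s -> s <= t -> t <= q ^- k ->
    `|F t - F s| <= K * (t - s).
  move=> ks st tk; have kt := le_trans ks st; have sk := le_trans st tk.
  rewrite /F !(FE _ k) ?ks ?kt// -mulrBr normrM normfV normrX.
  have /andP[a1 _] : 1 <= q ^+ k.+1 * s <= q by apply: scaled; rewrite ks.
  have /andP[_ a2] : 1 <= q ^+ k.+1 * t <= q by apply: scaled; rewrite kt.
  have a3 : q ^+ k.+1 * s <= q ^+ k.+1 * t by rewrite ler_wpM2l// ltW ?exprn_gt0.
  rewrite (le_trans (ler_wpM2l _ (Lf _ _ a1 a3 a2)))// -mulrBr.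
  rewrite (le_trans (ler_wpM2r _ (rhoq k.+1)))//.
    by rewrite !mulr_ge0 ?subr_ge0// ltW ?exprn_gt0.
  by rewrite mulrCA [_^-1 * _]mulrA mulVf ?gt_eqF ?exprn_gt0// mul1r.
have away n : forall s t, q ^- n <= s -> s <= t -> t <= 1 -> `|F t - F s| <= K * (t - s).
  elim: n => [s t|n IH s t ns st t1].
    rewrite expr0 invr1 => s1 st t1.
    have -> : t = s by lra.
    by rewrite !subrr normr0 mulr0.
  have [ns'|sn] := leP (q ^- n) s; first exact: IH.
  have [nt|tn] := leP (q ^- n) t; last exact: piece ns st (ltW tn).
  rewrite -(subrKA (F (q ^- n)) (F t)) (le_trans (ler_normD _ _))//.
  rewrite -(subrKA (q ^- n) t) mulrDr; apply: lerD.
    exact: IH (lexx _) nt t1.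
  exact: piece ns (ltW sn) (lexx _).
move=> s t; rewrite le_eqVlt => /predU1P[<-|s0] st t1; last first.
  by have [n /ltW ns] := exists_expVn_lt s0; exact: away ns st t1.
rewrite [F 0]selfsim0// !subr0.
move: st; rewrite le_eqVlt => /predU1P[<-|t0]; first by rewrite [F 0]selfsim0// normr0 mulr0.
have [k /[dup] kt /andP[kt1 kt2]] := exists_scale t0 t1.
rewrite /F (selfsim_open _ _ kt) normrM normfV normrX mulrC ler_pM//.
  by apply: bf; apply: scaled; rewrite ltW.
exact: le_trans (rhoq _) (ltW kt1).
Qed.

Lemma selfsim_is_derive rho f f' s k : (forall x : R, is_derive x (1 : R) f (f' x)) ->
  q ^- k.+1 < s < q ^- k ->
  is_derive s 1 (selfsim rho f) (selfsim (rho / q) f' s).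
Proof.
move=> df /andP[ks sk].
rewrite (@selfsim_open _ f' _ k) ?ks ?ltW//.
apply: (@near_eq_is_derive _ _ _ (fun t => rho ^- k.+1 * f (q ^+ k.+1 * t))).
  have sI : s \in `]q ^- k.+1, q ^- k[ by rewrite in_itv/= ks sk.
  apply: filterS (near_in_itvoo sI) => y; rewrite in_itv/= => /andP[y1 y2].
  by rewrite (@selfsim_open _ _ _ k)// y1 ltW.
have dq : is_derive s 1 (fun t : R => q ^+ k.+1 * t) (q ^+ k.+1).
  by apply: is_derive_eq; rewrite /GRing.scale/= mulr1.
have dc := @is_derive1_comp _ f _ s _ _ (df (q ^+ k.+1 * s)) dq.
have := is_deriveZ (rho ^- k.+1) dc.
rewrite /GRing.scale/=; congr is_derive.
rewrite exprMn exprVn invfM invrK; ring.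
Qed.

End self_similar.

(** * The self-similar extremal of Fuller's problem *)

Section fuller.
Context {R : realType}.

Lemma C1_lipschitz_bounded (f f' : R -> R) (a b : R) : a <= b ->
  (forall x : R, is_derive x (1 : R) f (f' x)) -> continuous f' ->
  exists K,
    (forall s t, a <= s -> s <= t -> t <= b -> `|f t - f s| <= K * (t - s)) /\
    (forall s, a <= s <= b -> `|f s| <= K).
Proof.
move=> ab df cf'.
have cf : continuous f.
  by move=> x; apply/differentiable_continuous/derivable1_diffP; have [] := df x.
have [u _ Hu] : exists2 u, u \in `[a, b] & forall t, t \in `[a, b] -> `|f t| <= `|f u|.
  apply: EVT_max => //; apply: continuous_subspaceT => x.
  exact: (continuous_comp (cf x) (@norm_continuous _ _ _)).
have [v _ Hv] : exists2 v, v \in `[a, b] & forall t, t \in `[a, b] -> `|f' t| <= `|f' v|.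
  apply: EVT_max => //; apply: continuous_subspaceT => x.
  exact: (continuous_comp (cf' x) (@norm_continuous _ _ _)).
exists (`|f u| + `|f' v|); split=> [s t as_ st tb|s sab]; last first.
  by rewrite ler_wpDr// Hu// in_itv.
have [|z zst ->] := @MVT_segment _ f f' s t st (fun x _ => df x).
  exact: continuous_subspaceT.
rewrite normrM (ger0_norm (_ : 0 <= t - s)) ?subr_ge0// ler_wpM2r ?subr_ge0//.
rewrite ler_wpDl// Hv//; move: zst; rewrite !in_itv/= => /andP[sz zt].
by rewrite (le_trans as_ sz) (le_trans zt tb).
Qed.

(** The largest root, close to 4.13; the polynomial is palindromic and
    [q + 1 / q = (3 + sqrt 33) / 2]. *)
Lemma exists_fuller_ratio : exists2 q : R, 4 <= q &
  q ^+ 4 - 3 * q ^+ 3 - 4 * q ^+ 2 - 3 * q + 1 = 0.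
Proof.
pose p : {poly R} := 'X^4 - 3%:P * 'X^3 - 4%:P * 'X^2 - 3%:P * 'X + 1%:P.
have pE x : p.[x] = x ^+ 4 - 3 * x ^+ 3 - 4 * x ^+ 2 - 3 * x + 1.
  by rewrite /p !hornerE.
have [||q q45 /rootP] := @poly_ivt R p 4 5.
- lra.
- by rewrite !pE; apply/andP; split; lra.
by rewrite pE => qE; exists q => //; have /andP[] := q45.
Qed.

(** The polynomial [f0 (1 + r) = a * r + b * r^2 / 2 + c * r^3 / 6 - r^4 / 24] on
    [1, q] is to satisfy [f0^(j) (q) = - q^(4 - j) * f0^(j) (1)] for [j <= 3].
    The conditions for [j = 3, 2, 1] determine [c], [b], [a] in turn; the one
    for [j = 0], which says that [f0] vanishes at [q], is the equation of the
    ratio [q]. *)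
Lemma exists_fuller_coefficients : exists q a b c : R, let d := q - 1 in
  [/\ 4 <= q, 0 < a, c - d = - q * c, b + c * d - d ^+ 2 / 2 = - q ^+ 2 * b &
    a + b * d + c * d ^+ 2 / 2 - d ^+ 3 / 6 = - q ^+ 3 * a /\
    a + b * d / 2 + c * d ^+ 2 / 6 - d ^+ 3 / 24 = 0].
Proof.
have [q q4 qE] := exists_fuller_ratio.
have q0 : 0 < q by lra.
have q10 : q + 1 != 0 by rewrite gt_eqF//; lra.
have q20 : 0 < q ^+ 2 + 1 by rewrite ltr_wpDl// exprn_ge0// ltW.
have q30 : 0 < q ^+ 3 + 1 by rewrite ltr_wpDl// exprn_ge0// ltW.
have q2n : q ^+ 2 + 1 != 0 by rewrite gt_eqF.
have q3n : q ^+ 3 + 1 != 0 by rewrite gt_eqF.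
exists q, ((q - 1) ^+ 3 * (q ^+ 2 - 3 * q + 1) / (6 * (q ^+ 2 + 1) * (q ^+ 3 + 1))).
exists ((q - 1) ^+ 3 / (2 * (q + 1) * (q ^+ 2 + 1))), ((q - 1) / (q + 1)) => /=.
split => //.
- rewrite !mulr_gt0 ?invr_gt0 ?mulr_gt0 ?exprn_gt0//; nra.
- by field.
- by field; rewrite ?q10 ?q2n ?q3n.
split; first by field; rewrite ?q10 ?q2n ?q3n.
transitivity (- (q - 1) ^+ 4 * (q ^+ 4 - 3 * q ^+ 3 - 4 * q ^+ 2 - 3 * q + 1) /
   (24 * (q ^+ 2 + 1) * (q ^+ 3 + 1))).
  by field; rewrite ?q10 ?q2n ?q3n.
by rewrite qE mulr0 mul0r.
Qed.

(** Dividing by the two known zeros [1] and [q] leaves a quadratic polynomial in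
    [x - 1] with nonnegative coefficients. *)
Lemma fuller_arc_gt0 (q a b c x : R) (d := q - 1) : 4 <= q -> 0 < a ->
  c - d = - q * c -> a + b * d / 2 + c * d ^+ 2 / 6 - d ^+ 3 / 24 = 0 ->
  1 < x < q -> 0 < a * (x - 1) + b * (x - 1) ^+ 2 / 2 + c * (x - 1) ^+ 3 / 6
    - (x - 1) ^+ 4 / 24.
Proof.
move=> q4 a0 E3 E0 /andP[x1 xq].
have d_gt0 : 0 < d by rewrite subr_gt0 (lt_le_trans _ q4)// ltr1n.
have q10 : 0 < q + 1 by rewrite addr_gt0// (lt_le_trans _ q4).
have q3 : 0 < q - 3 by rewrite subr_gt0 (lt_le_trans _ q4)// ltr_nat.
have bE : b = 2 * (d ^+ 2 / 24 - c * d / 6 - a / d).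
  transitivity (b * d / 2 * (2 / d)); first by field; rewrite gt_eqF.
  have -> : b * d / 2 = d ^+ 3 / 24 - c * d ^+ 2 / 6 - a by clear -E0; lra.
  by field; rewrite gt_eqF.
have cE : d / 24 - c / 6 = d * (q - 3) / (24 * (q + 1)).
  have -> : c = d / (q + 1).
    apply: (mulIf (negbT (gt_eqF q10))); rewrite mulfVK ?gt_eqF//.
    by clear -E3; lra.
  by rewrite /d; field; rewrite gt_eqF.
have -> : a * (x - 1) + b * (x - 1) ^+ 2 / 2 + c * (x - 1) ^+ 3 / 6
    - (x - 1) ^+ 4 / 24 = (x - 1) * (q - x) *
   (a / d + (d / 24 - c / 6) * (x - 1) + (x - 1) ^+ 2 / 24).
  have -> : q - x = d - (x - 1) by rewrite /d; ring.
  by rewrite bE; field; rewrite gt_eqF.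
rewrite mulr_gt0 ?mulr_gt0 ?subr_gt0//.
rewrite ltr_wpDr ?divr_ge0 ?sqr_ge0// ltr_wpDr ?divr_gt0//.
rewrite cE mulr_ge0 ?subr_ge0 ?(ltW x1)// divr_ge0// mulr_ge0// ltW//.
Qed.

Definition unit_lipschitz (K : R) (F : R -> R) :=
  forall s t, 0 <= s -> s <= t -> t <= 1 -> `|F t - F s| <= K * (t - s).

(** [F0] is the adjoint variable of Fuller's problem in reversed time, [F1], [F2],
    [F3] its derivatives, and [G] a primitive of the running cost.  The last
    item says that the third derivative of [F0] has slope [- sgn F0]. *)
Theorem exists_fuller_extremal : exists (q K : R) (F0 F1 F2 F3 G : R -> R),
  [/\ 2 <= q,
    [/\ unit_lipschitz K F0, unit_lipschitz K F1, unit_lipschitz K F2,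
        unit_lipschitz K F3 & unit_lipschitz K G],
    (forall k s, q ^- k.+1 < s < q ^- k ->
      [/\ is_derive s (1 : R) F0 (F1 s), is_derive s (1 : R) F1 (F2 s),
          is_derive s (1 : R) F2 (F3 s), is_derive s (1 : R) F3 ((-1) ^+ k) &
          is_derive s (1 : R) G (F2 s ^+ 2 / 2)]) &
    (forall k s, q ^- k.+1 < s < q ^- k -> F0 s * (-1) ^+ k <= 0)].
Proof.
have [q [a [b [c]]]] := exists_fuller_coefficients.
set d := q - 1 => -[q4 a0 E3 E2 [E1 E0]].
have q2 : 2 <= q by lra.
have q1 : 1 <= q by lra.
have q0 : 0 < q by lra.
pose f0 (s : R) := a * (s - 1) + b * (s - 1) ^+ 2 / 2 + c * (s - 1) ^+ 3 / 6
  - (s - 1) ^+ 4 / 24.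
pose f1 (s : R) := a + b * (s - 1) + c * (s - 1) ^+ 2 / 2 - (s - 1) ^+ 3 / 6.
pose f2 (s : R) := b + c * (s - 1) - (s - 1) ^+ 2 / 2.
pose f3 (s : R) := c - (s - 1).
pose f4 (s : R) := (-1 : R).
pose g' (s : R) := f2 s ^+ 2 / 2.
pose P (r : R) := (b ^+ 2 * r + b * c * r ^+ 2 + (c ^+ 2 - b) * r ^+ 3 / 3
   - c * r ^+ 4 / 4 + r ^+ 5 / 20) / 2.
(* [P] is the primitive of [f2 (1 + r)^2 / 2] that vanishes at 0; the constant
   below is the one for which [g q = q^5 * g 1]. *)
pose g (s : R) := P d / (q ^+ 5 - 1) + P (s - 1).
have d0 (s : R) : is_derive s (1 : R) f0 (f1 s).
  by apply: is_derive_eq; rewrite /GRing.scale/= /f1; field.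
have d1 (s : R) : is_derive s (1 : R) f1 (f2 s).
  by apply: is_derive_eq; rewrite /GRing.scale/= /f2; field.
have d2 (s : R) : is_derive s (1 : R) f2 (f3 s).
  by apply: is_derive_eq; rewrite /GRing.scale/= /f3; field.
have d3 (s : R) : is_derive s (1 : R) f3 (f4 s).
  by apply: is_derive_eq; rewrite /f4; ring.
have dg (s : R) : is_derive s (1 : R) g (g' s).
  by apply: is_derive_eq; rewrite /GRing.scale/= /g' /f2; field.
have cont (f f' : R -> R) : (forall x : R, is_derive x (1 : R) f (f' x)) -> continuous f.
  by move=> df x; apply/differentiable_continuous/derivable1_diffP; have [] := df x.
have cg' : continuous g'.
  apply: (cont _ (fun s => f2 s * f3 s)) => x; rewrite /g'.
  by apply: is_derive_eq; rewrite /GRing.scale/=; field.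
have cf4 : continuous f4 by move=> x; exact: cst_continuous.
have [K0 [L0 B0]] := C1_lipschitz_bounded q1 d0 (cont _ _ d1).
have [K1 [L1 B1]] := C1_lipschitz_bounded q1 d1 (cont _ _ d2).
have [K2 [L2 B2]] := C1_lipschitz_bounded q1 d2 (cont _ _ d3).
have [K3 [L3 B3]] := C1_lipschitz_bounded q1 d3 cf4.
have [K4 [L4 B4]] := C1_lipschitz_bounded q1 dg cg'.
have m0 : f0 q = - q ^+ 4 * f0 1.
  rewrite /f0 subrr -/d.
  transitivity (d * (a + b * d / 2 + c * d ^+ 2 / 6 - d ^+ 3 / 24)); first by field.
  by rewrite E0; ring.
have m1 : f1 q = - q ^+ 3 * f1 1 by rewrite /f1 subrr -/d E1; ring.
have m2 : f2 q = - q ^+ 2 * f2 1 by rewrite /f2 subrr -/d E2; ring.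
have m3 : f3 q = - q * f3 1 by rewrite /f3 subrr -/d E3; ring.
have q5 : q ^+ 5 - 1 != 0 by rewrite subr_eq0 gt_eqF// exprn_egt1//; lra.
have mg : g q = q ^+ 5 * g 1.
  by rewrite /g subrr -/d /P; field.
have qle (n : nat) : q <= `|- q ^+ n.+1|.
  by rewrite normrN ger0_norm ?ler_eXnr// exprn_ge0// ltW.
pose K := Num.max K0 (Num.max K1 (Num.max K2 (Num.max K3 K4))).
have Lip rho f L : q <= `|rho| -> f q = rho * f 1 ->
  (forall s t, 1 <= s -> s <= t -> t <= q -> `|f t - f s| <= L * (t - s)) ->
  (forall s, 1 <= s <= q -> `|f s| <= L) -> L <= K ->
  unit_lipschitz K (selfsim q rho f).
  move=> qrho fq Lf Bf LK s t s0 st t1.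
  rewrite (le_trans (selfsim_lipschitz q2 qrho fq Lf Bf s0 st t1))//.
  by rewrite ler_wpM2r// subr_ge0.
have K_ge : [/\ K0 <= K, K1 <= K, K2 <= K, K3 <= K & K4 <= K].
  by rewrite /K !le_max !lexx !orbT.
case: K_ge => K0K K1K K2K K3K K4K.
exists q, K, (selfsim q (- q ^+ 4) f0), (selfsim q (- q ^+ 3) f1),
  (selfsim q (- q ^+ 2) f2), (selfsim q (- q) f3), (selfsim q (q ^+ 5) g).
split => //.
- split.
  + exact: Lip (qle 3%N) m0 L0 B0 K0K.
  + exact: Lip (qle 2%N) m1 L1 B1 K1K.
  + exact: Lip (qle 1%N) m2 L2 B2 K2K.
  + by apply: Lip (qle 0%N) _ L3 B3 K3K; rewrite expr1.
  + by apply: Lip _ mg L4 B4 K4K; rewrite -normrN qle.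
- move=> k s sk.
  have ratio n : - q ^+ n.+1 / q = - q ^+ n.
    by rewrite exprSr mulNr mulfK// gt_eqF.
  split.
  + by rewrite -(ratio 3%N); exact: selfsim_is_derive sk.
  + by rewrite -(ratio 2%N); exact: selfsim_is_derive sk.
  + by have := selfsim_is_derive q2 (- q ^+ 2) d2 sk; rewrite ratio expr1.
  + have := selfsim_is_derive q2 (- q) d3 sk.
    rewrite mulNr mulfV ?gt_eqF// (selfsim_open q2 _ _ (k := k)); last first.
      by case/andP: sk => -> /ltW.
    by rewrite /f4 mulrN1 -exprVn invrN1 exprS mulN1r opprK.
  + have := selfsim_is_derive q2 (q ^+ 5) dg sk.
    rewrite exprSr mulfK ?gt_eqF//; congr is_derive.
    rewrite /selfsim /g'; case: ifP => _; last by rewrite expr0n mul0r.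
    set n := (scale q s).+1.
    have <- : ((- q ^+ 2) ^- n) ^+ 2 = (q ^+ 4) ^- n.
      by rewrite exprVn -(exprM (- q ^+ 2)) mulnC exprM sqrrN -(exprM q 2).
    by rewrite exprMn mulrA.
- move=> k s /andP[ks sk]; rewrite (selfsim_open q2 _ _ (k := k)) ?ks ?(ltW sk)//.
  set x := q ^+ k.+1 * s.
  have x1 : 1 < x by rewrite /x -ltr_pdivrMl ?exprn_gt0// mulr1.
  have xq : x < q.
    by rewrite /x -ltr_pdivlMl ?exprn_gt0// exprSr invfM mulfVK ?gt_eqF.
  have f0x : 0 < f0 x by apply: (fuller_arc_gt0 q4 a0 E3 E0); rewrite x1.
  have -> : (- q ^+ 4) ^- k.+1 = - ((-1) ^+ k * (q ^+ 4) ^- k.+1).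
    by rewrite (exprNn (q ^+ 4)) invfM invr_sign exprS mulN1r mulNr.
  have -> : - ((-1) ^+ k * (q ^+ 4) ^- k.+1) * f0 x * (-1) ^+ k =
      - (((-1) ^+ k) ^+ 2 * ((q ^+ 4) ^- k.+1 * f0 x)) by ring.
  rewrite sqrr_sign mul1r oppr_le0 ltW// mulr_gt0// invr_gt0 exprn_gt0//.
  exact: exprn_gt0.
Qed.

End fuller.

(** * Horizontal curves and their lengths *)

Section horizontal.
Context {R : realType}.
Implicit Types (x xi : 'rV[R]_6) (v u : R).

Lemma coE x (i : 'I_6) : x ord0 i = x..[i.+1].
Proof. by rewrite /co/=; congr (x _ _); apply/val_inj; rewrite /= inordK. Qed.

Lemma co_inj x y : (forall k, (k < 6)%N -> x..[k.+1] = y..[k.+1]) -> x = y.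
Proof.
move=> xy; apply/matrixP => i j; rewrite (ord1 i) !coE; exact/xy.
Qed.

Lemma horizontalE x v u : v *: g1 x + u *: g2 x =
  vec6 v u (- (x..[2] * v)) (- (x..[3] * v)) (- (x..[1] * x..[3] * v))
    (2^-1 * x..[3] ^+ 2 * v).
Proof.
by apply/rowP => -[[|[|[|[|[|[|//]]]]]] h]; rewrite !mxE/= ?mxE/=; ring.
Qed.

Lemma sum_frameE x (eta : 'rV[R]_6) :
  \sum_(i < 6) eta 0 i *: row i (frame x) =
  eta..[1] *: g1 x + eta..[2] *: g2 x + eta..[3] *: g3 x + eta..[4] *: g4 x +
  eta..[5] *: g5 x + eta..[6] *: g6 x.
Proof.
rewrite !big_ord_recl big_ord0 !rowK !coE/= !addrA addr0.
by [].
Qed.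

Lemma coords_horizontal x v u :
  coords x (v *: g1 x + u *: g2 x) = vec6 v u 0 0 0 0.
Proof.
apply/esym/coordsP; rewrite sum_frameE !co_vec6//= !scale0r !addr0.
by [].
Qed.

Lemma finsler_horizontal x v u :
  finsler x (v *: g1 x + u *: g2 x) = (Num.max `|v| `|u|)%:E.
Proof. by rewrite /finsler coords_horizontal !co_vec6//= eqxx. Qed.

Lemma finsler_fin x xi (c : R) : finsler x xi = c%:E ->
  exists v u, [/\ xi = v *: g1 x + u *: g2 x, `|v| <= c & `|u| <= c].
Proof.
rewrite /finsler; case: ifPn => // /and4P[/eqP h3 /eqP h4 /eqP h5 /eqP h6] [<-].
exists (coords x xi)..[1], (coords x xi)..[2]; split.
- have /coordsP := erefl (coords x xi).
  by rewrite sum_frameE h3 h4 h5 h6 !scale0r !addr0.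
- by rewrite le_max lexx.
- by rewrite le_max lexx orbT.
Qed.

Lemma finsler_ge_co1 x xi : (`|xi..[1]|%:E <= finsler x xi)%E.
Proof.
have [->|[c fc]] : finsler x xi = +oo%E \/ exists c, finsler x xi = c%:E.
- by rewrite /finsler; case: ifP => _; [right; eexists|left].
- by rewrite leey.
rewrite fc lee_fin; have [v [u [-> vc _]]] := finsler_fin fc.
by rewrite horizontalE co_vec6.
Qed.

Lemma finsler_ge0 x xi : (0 <= finsler x xi)%E.
Proof. by apply: le_trans (finsler_ge_co1 x xi); rewrite lee_fin. Qed.

Lemma is_derive_co (y : R -> 'rV[R]_6) (t : R) k : derivable y t 1 ->
  is_derive t (1 : R) (fun s => (y s)..[k]) (derive1 y t)..[k].
Proof.
move=> dy; apply: DeriveDef; first exact: (derivable_mxP _ _ _).1 dy _ _.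
by rewrite derive1E derive_mx// /co mxE.
Qed.

Lemma derive1_co (y : R -> 'rV[R]_6) (t : R) (l : 'rV[R]_6) :
  (forall k, (k < 6)%N ->
    is_derive t (1 : R) (fun s => (y s)..[k.+1]) l..[k.+1]) ->
  derive1 y t = l.
Proof.
move=> dy; have dyt : derivable y t 1.
  apply/derivable_mxP => i j; rewrite (ord1 i).
  have <- : (fun s => (y s)..[j.+1]) = (fun s => y s ord0 j).
    by apply/funext => s; rewrite coE.
  by have [] := dy j (ltn_ord j).
apply: co_inj => k k6; have [_ <-] := dy k k6.
by have [_ <-] := is_derive_co k.+1 dyt.
Qed.

End horizontal.

Section curves.
Context {R : realType}.
Implicit Types (p q : 'rV[R]_6) (y : R -> 'rV[R]_6) (a b t : R).
Local Notation mu := (@lebesgue_measure R).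

Lemma abs_continuous_co y a b k : abs_continuous a b y ->
  abs_continuous a b (fun t => (y t)..[k]).
Proof. exact: abs_continuous_coord. Qed.

Lemma lipschitz_abs_continuous_row (f : R -> 'rV[R]_6) (a b : R) :
  (forall k, (k < 6)%N -> exists K, forall s t, a <= s -> s <= t -> t <= b ->
    `|(f t)..[k.+1] - (f s)..[k.+1]| <= K * (t - s)) ->
  abs_continuous a b f.
Proof.
move=> fK; have fK' (k : 'I_6) : exists K, forall s t, a <= s -> s <= t -> t <= b ->
    `|(f t)..[k.+1] - (f s)..[k.+1]| <= K * (t - s) by exact: fK.
have [K HK] := choice fK'.
apply: (@lipschitz_abs_continuous _ _ _ _ _ (\sum_i `|K i|)) => s t as_ st tb.
rewrite [leLHS]/Num.Def.normr/= mx_normrE bigmax_le//.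
  by rewrite mulr_ge0 ?subr_ge0// sumr_ge0.
move=> [i j] _; rewrite !mxE/= (ord1 i) !coE (le_trans (HK j _ _ as_ st tb))//.
rewrite ler_wpM2r ?subr_ge0// (le_trans (ler_norm _))//.
by rewrite (bigD1 j)//= lerDl sumr_ge0.
Qed.

Lemma abs_continuous_row_ae_derivable y a b : a < b -> abs_continuous a b y ->
  {ae mu, forall t, a < t < b -> derivable y t 1}.
Proof.
move=> ab acy.
have : {ae mu, forall t, forall i : 'I_6, a < t < b ->
    derivable (fun s => y s ord0 i) t 1}.
  apply: filter_forall => i; apply: abs_continuous_ae_derivable => //.
  exact: abs_continuous_coord.
apply: filterS => t dy atb; apply/derivable_mxP => i j; rewrite (ord1 i).
exact: dy.
Qed.

(** The lower bound comes from the first coordinate of the velocity alone, which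
    is also its first coordinate in the frame. *)
Lemma curve_length_ge p q a b y : joins p q a b y ->
  ((q..[1] - p..[1])%:E <= curve_length a b y)%E.
Proof.
move=> [ab acy <- <-]; apply: (@abs_continuous_le_length _ a b (fun t => (y t)..[1])) => //.
- exact: abs_continuous_co.
- by move=> t; exact: finsler_ge0.
move: ab; rewrite le_eqVlt => /predU1P[->|ab].
  by apply: aeW => t /andP[/lt_trans h /h]; rewrite ltxx.
apply: filterS (abs_continuous_row_ae_derivable ab acy) => t dy /dy dyt l dl.
have <- : (derive1 y t)..[1] = l.
  by have [_ <-] := is_derive_co 1 dyt; have [_ <-] := dl.
exact: finsler_ge_co1.
Qed.

Lemma natural_curve_length a b y : a <= b -> natural_param a b y ->
  curve_length a b y = (b - a)%:E.
Proof.
move=> ab ny; rewrite /curve_length.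
have mab : @measurable _ (measurableTypeR R) `[a, b]%classic.
  exact: measurable_itv.
rewrite (@ge0_ae_eq_cst_integral _ _ _ _ _ _ 1 mab)//; last first.
  by move=> t _; exact: finsler_ge0.
rewrite mul1e [LHS]lebesgue_measure_itv/= lte_fin.
have [//|ba] := ltP; have -> : b = a by apply/le_anti; rewrite ab ba.
by rewrite subrr.
Qed.

Lemma natural_param_control a b y : a < b -> abs_continuous a b y ->
  natural_param a b y ->
  {ae mu, forall t, a < t < b -> exists v u : R,
    [/\ `|v| <= 1, `|u| <= 1 & forall k,
    is_derive t (1 : R) (fun s => (y s)..[k]) (v *: g1 (y t) + u *: g2 (y t))..[k]]}.
Proof.
move=> ab acy ny.
apply: filterS2 (abs_continuous_row_ae_derivable ab acy) ny => t dy fy atb.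
have [|v [u [yE v1 u1]]] := finsler_fin (fy _).
  by rewrite in_itv/=; case/andP: atb => /ltW-> /ltW->.
exists v, u; split=> // k; rewrite -yE; exact/is_derive_co/dy.
Qed.

End curves.

(** * The chattering curve *)

Section extremal.
Context {R : realType}.
Variables (q K : R) (F0 F1 F2 F3 G : R -> R).
Hypothesis q2 : 2 <= q.
Hypothesis L0 : unit_lipschitz K F0.
Hypothesis L1 : unit_lipschitz K F1.
Hypothesis L2 : unit_lipschitz K F2.
Hypothesis L3 : unit_lipschitz K F3.
Hypothesis LG : unit_lipschitz K G.
Hypothesis dF : forall k s, q ^- k.+1 < s < q ^- k ->
  [/\ is_derive s (1 : R) F0 (F1 s), is_derive s (1 : R) F1 (F2 s),
      is_derive s (1 : R) F2 (F3 s), is_derive s (1 : R) F3 ((-1) ^+ k) &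
      is_derive s (1 : R) G (F2 s ^+ 2 / 2)].
Hypothesis sF : forall k s, q ^- k.+1 < s < q ^- k -> F0 s * (-1) ^+ k <= 0.
Local Notation mu := (@lebesgue_measure R).

(** Since [F1] and [F0] are successive primitives of [F2], the fourth coordinate
    has derivative [- F2 (1 - t)] and the fifth [- t * F2 (1 - t)]. *)
Definition extremal (t : R) : 'rV[R]_6 :=
  vec6 t (F3 (1 - t)) (F2 (1 - t)) (F1 (1 - t)) (t * F1 (1 - t) + F0 (1 - t))
    (- G (1 - t)).

Local Notation X := extremal.

Let q1 : 1 < q. Proof. by rewrite (lt_le_trans _ q2)// ltr1n. Qed.
Let q0 : 0 < q. Proof. exact: lt_trans q1. Qed.

Lemma is_derive_reflect (f : R -> R) (t l : R) : is_derive (1 - t) (1 : R) f l ->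
  is_derive t (1 : R) (fun s => f (1 - s)) (- l).
Proof.
move=> df; have dr : is_derive t (1 : R) (fun s : R => 1 - s) (-1).
  by apply: is_derive_eq; ring.
by have := @is_derive1_comp _ f _ t _ _ df dr; rewrite mulrN1.
Qed.

Lemma extremal_is_derive k t : q ^- k.+1 < 1 - t < q ^- k -> forall j, (j < 6)%N ->
  is_derive t (1 : R) (fun s => (extremal s)..[j.+1])
    (1 *: g1 (extremal t) + (- (-1) ^+ k) *: g2 (extremal t))..[j.+1].
Proof.
move=> tk; have [d0 d1 d2 d3 dg] := dF tk.
move/is_derive_reflect in d0; move/is_derive_reflect in d1.
move/is_derive_reflect in d2; move/is_derive_reflect in d3.
move/is_derive_reflect in dg.
have did : is_derive t (1 : R) (fun s : R => s) 1 by exact: is_derive_id.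
have E i s : (i < 6)%N -> (extremal s)..[i.+1] =
  [:: s; F3 (1 - s); F2 (1 - s); F1 (1 - s); s * F1 (1 - s) + F0 (1 - s);
   - G (1 - s)]`_i by move=> i6; rewrite co_vec6.
move=> j j6; rewrite horizontalE co_vec6// !E//.
rewrite (_ : (fun s => _) = fun s => [:: s; F3 (1 - s); F2 (1 - s); F1 (1 - s);
  s * F1 (1 - s) + F0 (1 - s); - G (1 - s)]`_j); last first.
  by apply/funext => s; rewrite E.
case: j j6 => [|[|[|[|[|[|//]]]]]] _ /=; rewrite ?mulr1 //.
- have := is_deriveD (is_deriveM did d1) d0; rewrite /GRing.scale/= mulr1.
  by congr is_derive; ring.
- by have := is_deriveN dg; rewrite opprK; congr is_derive; ring.
Qed.

Lemma extremal_derive1 k t : q ^- k.+1 < 1 - t < q ^- k ->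
  derive1 extremal t = 1 *: g1 (extremal t) + (- (-1) ^+ k) *: g2 (extremal t).
Proof. by move=> tk; apply: derive1_co; exact: extremal_is_derive tk. Qed.

Lemma extremal_control k t : q ^- k.+1 < 1 - t < q ^- k ->
  control extremal t = (1, - (-1) ^+ k).
Proof.
by move=> tk; rewrite /control (extremal_derive1 tk) coords_horizontal !co_vec6.
Qed.

Let norm_sign k : `|- (-1) ^+ k| = 1 :> R.
Proof. by rewrite normrN normrX normrN1 expr1n. Qed.

Lemma ae_scale : {ae mu, forall t, 0 <= t <= 1 ->
  exists k, q ^- k.+1 < 1 - t < q ^- k}.
Proof.
(* A null set: the switches and their accumulation point. *)
pose c n : R := if n is k.+1 then 1 - q ^- k else 1.
have cE : countable (range c) by exact: card_image_le.
exists (range c); split.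
- by apply: countable_measurable => // t; exact: measurable_set1.
- exact: countable_lebesgue_measure0.
move=> t /= tE; apply: contrapT => tc; apply: tE => /andP[t0 tl1].
have s0 : 0 < 1 - t.
  rewrite subr_gt0 lt_neqAle tl1 andbT; apply/negP => /eqP t1.
  by apply: tc; exists 0%N.
have [|k /andP[k1 k2]] := exists_scale q2 s0; first by rewrite gerBl.
exists k; rewrite k1 lt_neqAle k2 andbT; apply/negP => /eqP tE.
by apply: tc; exists k.+1 => //=; rewrite -tE subKr.
Qed.

Lemma unit_lipschitz_reflect (F : R -> R) : unit_lipschitz K F ->
  forall s t, 0 <= s -> s <= t -> t <= 1 -> `|F (1 - t) - F (1 - s)| <= K * (t - s).
Proof.
move=> LF s t s0 st t1; rewrite distrC.
by have := LF (1 - t) (1 - s); rewrite opprB addrCA addrAC subrr add0r addrC; apply; lra.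
Qed.

Lemma reflect_abs_continuous (F : R -> R) : unit_lipschitz K F ->
  abs_continuous 0 1 (fun t => F (1 - t)).
Proof.
by move=> /unit_lipschitz_reflect LF; exact: lipschitz_abs_continuous LF.
Qed.

Lemma extremal_abs_continuous : abs_continuous 0 1 extremal.
Proof.
have K0 : 0 <= K.
  by have := L0 (lexx 0) ler01 (lexx 1); rewrite subr0 mulr1; exact: le_trans.
apply: lipschitz_abs_continuous_row.
case=> [|[|[|[|[|[|//]]]]]] _.
- by exists 1 => s t _ st _; rewrite !co_vec6//= mul1r ger0_norm// subr_ge0.
- by exists K => s t s0 st t1; rewrite !co_vec6//=; exact: unit_lipschitz_reflect.
- by exists K => s t s0 st t1; rewrite !co_vec6//=; exact: unit_lipschitz_reflect.
- by exists K => s t s0 st t1; rewrite !co_vec6//=; exact: unit_lipschitz_reflect.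
- exists (K + (`|F1 1| + K) + K) => s t s0 st t1; rewrite !co_vec6//=.
  have -> : t * F1 (1 - t) + F0 (1 - t) - (s * F1 (1 - s) + F0 (1 - s)) =
    t * (F1 (1 - t) - F1 (1 - s)) + (t - s) * F1 (1 - s) +
    (F0 (1 - t) - F0 (1 - s)) by ring.
  rewrite (le_trans (ler_normD _ _))// [in leRHS]mulrDl lerD//; last first.
    exact: unit_lipschitz_reflect.
  rewrite (le_trans (ler_normD _ _))// [in leRHS]mulrDl !normrM lerD//.
    rewrite (ger0_norm (le_trans s0 st)).
    by rewrite (le_trans _ (unit_lipschitz_reflect L1 s0 st t1))// ler_piMl.
  rewrite [`|t - s|]ger0_norm ?subr_ge0// mulrC ler_wpM2r ?subr_ge0//.
  rewrite -[F1 _](subrK (F1 1)) (le_trans (ler_normD _ _))// addrC lerD2l.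
  have := @unit_lipschitz_reflect F1 L1 0 s (lexx 0) s0 (le_trans st t1).
  rewrite !subr0 => /le_trans; apply.
  by rewrite ler_piMr// (le_trans st).
- exists K => s t s0 st t1; rewrite !co_vec6//= -opprD normrN.
  exact: unit_lipschitz_reflect.
Qed.

Lemma extremal_natural : natural_param 0 1 extremal.
Proof.
apply: filterS ae_scale => t tk; rewrite in_itv/= => /tk[k {}tk].
by rewrite (extremal_derive1 tk) finsler_horizontal normr1 norm_sign maxxx.
Qed.

(** The competitor has the same first coordinate; then the function [Phi] below
    compares its Fuller cost with that of the extremal. *)
Lemma extremal_unique (y : R -> 'rV[R]_6) : abs_continuous 0 1 y ->
  natural_param 0 1 y -> y 0 = X 0 -> y 1 = X 1 -> {in `[0, 1], y =1 X}.
Proof.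
move=> acy ny y0 y1.
have acX : abs_continuous 0 1 X by exact: extremal_abs_continuous.
pose h k t := (y t)..[k] - (X t)..[k].
have ach k : abs_continuous 0 1 (h k).
  by apply: abs_continuousB; exact: abs_continuous_co.
have h0 k : h k 0 = 0 by rewrite /h y0 subrr.
have h1 k : h k 1 = 0 by rewrite /h y1 subrr.
have sub01 (a b s : R) : 0 <= a -> b <= 1 -> a < s < b -> 0 < s < 1.
  by move=> a0 b1 /andP[/(le_lt_trans a0)-> /lt_le_trans->].
have open01 (s : R) : 0 < s < 1 -> 0 <= s <= 1.
  by move=> /andP[/ltW-> /ltW->].
have yder := natural_param_control ltr01 acy ny.
have ae_piece : {ae mu, forall t, 0 < t < 1 -> exists k, q ^- k.+1 < 1 - t < q ^- k}.
  by apply: filterS ae_scale => t tk /andP[/ltW t0 /ltW t1]; apply: tk; rewrite t0.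
have both : {ae mu, forall t, 0 < t < 1 -> exists k v u,
    [/\ q ^- k.+1 < 1 - t < q ^- k, `|v| <= 1, `|u| <= 1 & forall j,
    is_derive t (1 : R) (fun s => (y s)..[j]) (v *: g1 (y t) + u *: g2 (y t))..[j]]}.
  apply: filterS2 ae_piece yder => t tk ty t01.
  by have [k ?] := tk t01; have [v [u [? ? ?]]] := ty t01; exists k, v, u.
have X1 t : (X t)..[1] = t by rewrite co_vec6.
(* The first coordinate is 1-Lipschitz and runs from 0 to 1 in unit time. *)
have h1E t : 0 <= t <= 1 -> h 1 t = 0.
  have mono a b : 0 <= a -> a <= b -> b <= 1 -> h 1 b <= h 1 a.
    move=> a0 ab b1; apply: abs_continuous_nonincreasing => //.
      exact: abs_continuousS (ach 1).
    apply: filterS both => s both_s /(sub01 _ _ _ a0 b1)/both_s.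
    move=> [k [v [u [_ v1 _ /(_ 1)]]]].
    rewrite horizontalE co_vec6//= => d1; exists (v - 1).
      rewrite (_ : h 1 = fun s => (y s)..[1] - s).
        exact: is_deriveB.
      by apply/funext => r; rewrite /h X1.
    by rewrite subr_le0 (le_trans (ler_norm v)).
  move=> /andP[t0 t1]; apply/le_anti; move: (mono _ _ (lexx 0) t0 t1).
  by move: (mono _ _ t0 t1 (lexx 1)); rewrite h0 h1 => -> ->.
have system : {ae mu, forall t, 0 < t < 1 -> exists k u,
    [/\ q ^- k.+1 < 1 - t < q ^- k, `|u| <= 1 & forall j, (j < 6)%N ->
    is_derive t (1 : R) (h j.+1)
      ((1 *: g1 (y t) + u *: g2 (y t))..[j.+1] -
       (1 *: g1 (X t) + (- (-1) ^+ k) *: g2 (X t))..[j.+1])]}.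
  apply: filterS both => t both_t t01; have [k [v [u [tk v1 u1 dy]]]] := both_t t01.
  have hj j : (j < 6)%N -> is_derive t (1 : R) (h j.+1)
      ((v *: g1 (y t) + u *: g2 (y t))..[j.+1] -
       (1 *: g1 (X t) + (- (-1) ^+ k) *: g2 (X t))..[j.+1]).
    by move=> j6; exact: is_deriveB (dy j.+1) (extremal_is_derive tk j6).
  suff vE : v = 1.
    by exists k, u; split=> // j j6; have := hj j j6; rewrite vE.
  have := is_derive_local_cst t01 (fun s s01 => h1E _ (open01 _ s01)) (hj 0%N isT).
  by rewrite !horizontalE !co_vec6//= => /eqP; rewrite subr_eq0 => /eqP.
(* The terms with [F1] cancel, and [F2 * h3 - (y3^2 - x3^2) / 2 = - h3^2 / 2]. *)
have Phi_deriv : {ae mu, forall t : R, 0 < t < 1 -> exists2 l, is_derive t (1 : R)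
    (fun s => F0 (1 - s) * h 2 s - F1 (1 - s) * h 3 s - h 6 s) l &
    l <= - (h 3 t ^+ 2 / 2)}.
  apply: filterS system => t sys t01; have [k [u [tk u1 dh]]] := sys t01.
  have [dF0 dF1 _ _ _] := dF tk.
  have d2 := dh 1%N isT; have d3 := dh 2%N isT; have d6 := dh 5%N isT.
  have := is_deriveB (is_deriveB (is_deriveM (is_derive_reflect dF0) d2)
    (is_deriveM (is_derive_reflect dF1) d3)) d6.
  rewrite !horizontalE !co_vec6//= /GRing.scale/= => dPhi; eexists; first exact: dPhi.
  have F0u : F0 (1 - t) * (u + (-1) ^+ k) <= 0.
    have := sF tk; have := u1; rewrite ler_norml => /andP[].
    by rewrite -signr_odd; case: odd; rewrite /= ?expr1 ?expr0; nra.
  rewrite [leLHS](_ : _ = F0 (1 - t) * (u + (-1) ^+ k) - h 3 t ^+ 2 / 2).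
    by rewrite gerDr.
  by rewrite /h !co_vec6//=; field.
have acPhi : abs_continuous 0 1
    (fun s => F0 (1 - s) * h 2 s - F1 (1 - s) * h 3 s - h 6 s).
  apply: abs_continuousB => //; apply: abs_continuousB;
    by apply: abs_continuousM => //; exact: reflect_abs_continuous.
have Phi0 t : 0 <= t <= 1 ->
    F0 (1 - t) * h 2 t - F1 (1 - t) * h 3 t - h 6 t = 0.
  set Phi := fun s => F0 (1 - s) * h 2 s - F1 (1 - s) * h 3 s - h 6 s.
  have mono a b : 0 <= a -> a <= b -> b <= 1 -> Phi b <= Phi a.
    move=> a0 ab b1; apply: abs_continuous_nonincreasing => //.
      exact: abs_continuousS acPhi.
    apply: filterS Phi_deriv => s Ps /(sub01 _ _ _ a0 b1)/Ps[l dl lh].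
    by exists l => //; rewrite (le_trans lh)// oppr_le0 divr_ge0// sqr_ge0.
  have e0 : Phi 0 = 0 by rewrite /Phi !h0 !mulr0 !subr0.
  have e1 : Phi 1 = 0 by rewrite /Phi !h1 !mulr0 !subr0.
  move=> /andP[t0 t1]; apply/le_anti; rewrite -/(Phi t).
  move: (mono _ _ (lexx 0) t0 t1) (mono _ _ t0 t1 (lexx 1)).
  by rewrite e0 e1 => -> ->.
have h3 : forall t, 0 <= t <= 1 -> h 3 t = 0.
  apply: abs_continuous_ae0 => //.
  apply: filterS Phi_deriv => t Pt t01; have [l dl lh] := Pt t01.
  have l0 : l = 0.
    exact: (is_derive_local_cst t01 (fun s s01 => Phi0 _ (open01 _ s01)) dl).
  apply/eqP; rewrite -sqrf_eq0 eq_le sqr_ge0 andbT.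
  by move: lh; rewrite l0; lra.
have h2 : forall t, 0 <= t <= 1 -> h 2 t = 0.
  apply: abs_continuous_ae0 => //.
  apply: filterS system => t sys t01; have [k [u [_ _ dh]]] := sys t01.
  have := is_derive_local_cst t01 (fun s s01 => h3 _ (open01 _ s01)) (dh 2%N isT).
  by rewrite !horizontalE /h !co_vec6//=; lra.
have hcst j : (2 < j < 6)%N -> forall t, 0 <= t <= 1 -> h j.+1 t = 0.
  move=> j36 t t01; rewrite -(h0 j.+1).
  apply: (abs_continuous_constant (ach j.+1)) => //.
  apply: filterS system => s sys s01; have [k [u [_ _ dh]]] := sys s01.
  have := h1E _ (open01 _ s01); have := h3 _ (open01 _ s01); rewrite /h.
  move/eqP; rewrite subr_eq0 => /eqP y3; move/eqP; rewrite subr_eq0 => /eqP y1E.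
  have := dh j; case: j j36 {dh} => [|[|[|[|[|[|//]]]]]]// _ /(_ isT);
    by rewrite !horizontalE !co_vec6//= ?y3 ?y1E ?co_vec6//= subrr.
move=> t; rewrite in_itv/= => t01; apply: co_inj => j j6.
apply/eqP; rewrite -subr_eq0 -/(h j.+1 t); apply/eqP.
by case: j j6 => [|[|[|j]]] j6; [exact: h1E|exact: h2|exact: h3|exact: hcst].
Qed.

Lemma extremal_switch k : switch_time 1 X (1 - q ^- k.+1).
Proof.
pose z := q ^- k.+2; have z0 : 0 < z by rewrite invr_gt0 exprn_gt0.
have zS : q ^- k.+1 = q * z by rewrite /z [q ^+ k.+2]exprS invfM mulrA mulfV ?mul1r// gt_eqF.
have zSS : q ^- k = q * (q * z).
  by rewrite -zS [q ^+ k.+1]exprS invfM mulrA mulfV ?mul1r// gt_eqF.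
have z1 : q * (q * z) <= 1.
  by rewrite -zSS invf_le1 ?exprn_gt0// exprn_ege1// ltW.
have qz : z < q * z by rewrite ltr_pMl.
have qqz : q * z - z <= q * (q * z) - q * z.
  by rewrite -[leRHS]mulrBr ler_peMl ?subr_ge0 ?ltW.
(* The radius is the length of the shorter adjacent interval. *)
exists (1, - (-1) ^+ k), (1, - (-1) ^+ k.+1), (q * z - z).
have vtx i : vertex (1 : R, - (-1) ^+ i).
  by split; rewrite /= ?normr1// normrN normrX normrN1 expr1n.
split.
- by split; exact: vtx.
- rewrite xpair_eqE eqxx/= eqr_opp exprS mulN1r -subr_eq0 opprK.
  by rewrite -mulr2n mulrn_eq0/= signr_eq0.
- by rewrite zS; split; [|split]; lra.
- apply: aeW => s; rewrite in_itv/= => /andP[s1 s2].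
  apply: extremal_control; rewrite zSS; rewrite !zS in s1 s2 *.
  by apply/andP; split; lra.
- apply: aeW => s; rewrite in_itv/= => /andP[s1 s2].
  apply: extremal_control; rewrite -/z; rewrite !zS in s1 s2 *.
  by apply/andP; split; lra.
Qed.

Lemma switch_timeP t : switch_time 1 X t -> exists k, t = 1 - q ^- k.
Proof.
move=> [w [w' [e [_ ww' [e0 [t0 t1]] wl wr]]]]; apply: contrapT => nt.
have s0 : 0 < 1 - t by lra.
have [|k /andP[k1 k2]] := exists_scale q2 s0; first by lra.
have k2' : 1 - t < q ^- k.
  rewrite lt_neqAle k2 andbT; apply/negP => /eqP tE; apply: nt; exists k.
  by rewrite -tE; ring.
have key a b c : a < b -> 1 - q ^- k < b -> a < 1 - q ^- k.+1 ->
    {ae mu, forall s : R, s \in `]a, b[ -> control X s = c} ->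
    c = (1, - (-1) ^+ k).
  move=> ab b1 a1 cE.
  have [||s [/andP[sa sb] <-]] := @ae_itv_exists _ (Num.max a (1 - q ^- k))
    (Num.min b (1 - q ^- k.+1)) (fun s => control X s = c).
  - rewrite lt_min !gt_max ab b1 a1/=; lra.
  - apply: filterS cE => s cs; rewrite in_itv/= gt_max lt_min.
    by move=> /andP[/andP[sa _] /andP[sb _]]; apply: cs; rewrite in_itv/= sa.
  move: sa sb; rewrite gt_max lt_min => /andP[_ sa] /andP[_ sb].
  by apply: extremal_control; apply/andP; split; lra.
move/negP : ww'; apply; apply/eqP.
by rewrite (key _ _ _ _ _ _ wl) ?(key _ _ _ _ _ _ wr)//; lra.
Qed.

Lemma extremal_chattering : chattering 1 X.
Proof.
exists 1; first by rewrite in_itv/= lexx ler01.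
move=> e e0; apply: eq_card_nat.
  apply: (@sub_countable _ _ _ (range (fun k => 1 - q ^- k))).
    by apply: subset_card_le => t [/switch_timeP[k ->] _]; exists k.
  exact: card_image_le.
have [N Ne] := exists_expVn_lt q2 e0.
pose f k := 1 - q ^- (N + k).+1.
have finj : injective f.
  move=> i j /addrI/oppr_inj/invr_inj/(ieexprIn q0) ij.
  by have /succn_inj/addnI := ij (negbT (gt_eqF q1)).
apply: (@sub_infinite_set _ (range f)).
  move=> _ [k _ <-]; split; first exact: extremal_switch.
  rewrite /f addrAC subrr sub0r normrN ger0_norm ?invr_ge0 ?exprn_ge0 ?(ltW q0)//.
  rewrite (le_lt_trans _ Ne)// lef_pV2 ?posrE ?exprn_gt0//.
  by rewrite ler_weXn2l ?(ltW q1)// leqW// leq_addr.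
have /card_eqPle[_ fE] : (range f #= [set: nat])%card.
  by apply: inj_card_eq => i j _ _; exact: finj.
exact/infiniteP.
Qed.

End extremal.

Theorem theorem4 (R : realType) :
  exists (p q : 'rV[R]_6) (T : R) (x : R -> 'rV[R]_6),
    unique_shortest p q T x /\ chattering T x.
Proof.
have [q [K [F0 [F1 [F2 [F3 [G [q2 [L0 L1 L2 L3 LG] dF sF]]]]]]]] :=
  @exists_fuller_extremal R.
pose X := extremal F0 F1 F2 F3 G.
have acX : abs_continuous 0 1 X by exact: (extremal_abs_continuous L0 L1 L2 L3 LG).
have nX : natural_param 0 1 X by exact: (extremal_natural q2 dF).
have jX : joins (X 0) (X 1) 0 1 X by split.
have lX : curve_length 0 1 X = 1%E by rewrite (natural_curve_length ler01 nX) subr0.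
have X10 : (X 1)..[1] - (X 0)..[1] = 1 by rewrite !co_vec6//= subr0.
have sX : shortest (X 0) (X 1) 0 1 X.
  split; first exact: jX.
  by move=> c d y jy; have := curve_length_ge jy; rewrite X10 lX.
exists (X 0), (X 1), 1, X; split; last exact: (extremal_chattering q2 dF).
split; [exact: sX|exact: nX|move=> S y sy ny]; have [[S0 acy y0 y1] ymin] := sy.
have S1 : S = 1.
  have := ymin _ _ _ jX; have := sX.2 _ _ _ sy.1.
  rewrite lX (natural_curve_length S0 ny) subr0 !lee_fin => ? ?; lra.
split; first exact: S1.
rewrite S1 in acy ny y1.
exact: (extremal_unique q2 L0 L1 L2 L3 LG dF sF).
Qed.
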